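(* For every $k\ge 3$, the clique $K_k$, the cycle $C_k$, and the wheel $W_k$ are KNRS-forcing. Moreover, if $H_1$ is a KNRS-forcing graph, $I\subseteq V(H_1)$ is an independent set, $a\in V(H_1)\setminus I$, and $H_2$ is a KNRS graph, then $H_1\ltimes_I^a H_2$ is KNRS-forcing.
   Context: All graphs are finite and simple. For graphs $H,G$, $t(H,G)$ denotes the probability that a uniformly random function $f:V(H)\to V(G)$ maps every edge of $H$ to an edge of $G$. For $S\subseteq V(G)$, $e(S)$ is the number of edges of $G$ with both endpoints in $S$. A graph $G$ is $(p,\delta)$-locally dense if every $S\subseteq V(G)$ with $|S|\ge\delta|V(G)|$ satisfies $e(S)\ge p|S|^2/2$. A graph $G$ is $(p,\delta)$-quasirandom if every $S\subseteq V(G)$ contains $\frac p2|S|^2\pm\delta\, v(G)^2$ edges. A graph $H$ is KNRS if for all $p,\varepsilon\in(0,1)$ there is $\delta>0$ such that every $(p,\delta)$-locally dense graph $G$ satisfies $t(H,G)\ge p^{e(H)}-\varepsilon$. A graph $H$ is KNRS-forcing if for all $p,\alpha\in(0,1)$ there exist $\delta,\varepsilon>0$ such that every $(p,\delta)$-locally dense graph $G$ satisfies $t(H,G)>p^{e(H)}+\varepsilon$ unless $G$ is $(p,\alpha)$-quasirandom. The wheel $W_k$ is obtained from the cycle $C_k$ by adding one new vertex adjacent to all vertices of the cycle. For graphs $H_1,H_2$, an independent set $I$ of $H_1$ and $a\in V(H_1)\setminus I$, the graph $H_1\ltimes_I^a H_2$ is defined as follows: take $v(H_2)$ copies $A_1,\dots,A_{v(H_2)}$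 of $H_1$ in which the vertices of $I$ are identified (shared by all copies) and which are otherwise vertex-disjoint; then place a copy of $H_2$ on the $v(H_2)$ vertices corresponding to $a$ in $A_1,\dots,A_{v(H_2)}$. *)

(* Defs.v *)
From HB Require Import structures.
From mathcomp Require Import all_boot all_order all_algebra.
From mathcomp Require Import reals.
Set Implicit Arguments. Unset Strict Implicit. Unset Printing Implicit Defensive.
Import Order.TTheory GRing.Theory Num.Theory.
Local Open Scope ring_scope.

Record sgraph := SGraph {
  vtx : finType;
  adj : rel vtx;
  adj_sym : symmetric adj;
  adj_irr : irreflexive adj }.
Arguments adj : clear implicits.

Definition is_edge (G : sgraph) (E : {set vtx G}) : bool :=
  [exists x, exists y, adj G x y && (E == [set x; y])].

Definition e_in (G : sgraph) (S : {set vtx G}) : nat :=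
  #|[set E : {set vtx G} | is_edge E && (E \subset S)]|.

Definition nedges (G : sgraph) : nat := e_in [set: vtx G].

Section Dens.
Variable R : realType.

Definition hom_dens (H G : sgraph) : R :=
  (#|[set f : {ffun vtx H -> vtx G} |
       [forall x, forall y, adj H x y ==> adj G (f x) (f y)]]|)%:R
  / (#|{: {ffun vtx H -> vtx G}}|)%:R.

Definition locally_dense (p delta : R) (G : sgraph) : Prop :=
  forall S : {set vtx G}, delta * (#|vtx G|)%:R <= (#|S|)%:R ->
    p * (#|S|)%:R ^+ 2 / 2 <= (e_in S)%:R.

Definition quasirandom (p delta : R) (G : sgraph) : Prop :=
  forall S : {set vtx G},
    `| (e_in S)%:R - p / 2 * (#|S|)%:R ^+ 2 | <= delta * (#|vtx G|)%:R ^+ 2.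

Definition KNRS (H : sgraph) : Prop :=
  forall p eps : R, 0 < p < 1 -> 0 < eps < 1 ->
    exists delta : R, 0 < delta /\
      forall G : sgraph, (0 < #|vtx G|)%N -> locally_dense p delta G ->
        p ^+ nedges H - eps <= hom_dens H G.

Definition KNRS_forcing (H : sgraph) : Prop :=
  forall p alpha : R, 0 < p < 1 -> 0 < alpha < 1 ->
    exists delta eps : R, [/\ 0 < delta, 0 < eps &
      forall G : sgraph, (0 < #|vtx G|)%N -> locally_dense p delta G ->
        p ^+ nedges H + eps < hom_dens H G \/ quasirandom p alpha G].
End Dens.

Local Open Scope nat_scope.

Lemma clique_sym k : symmetric (fun i j : 'I_k => i != j).
Proof. by move=> i j; rewrite eq_sym. Qed.
Lemma clique_irr k : irreflexive (fun i j : 'I_k => i != j).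
Proof. by move=> i; rewrite eqxx. Qed.
Definition clique_graph (k : nat) : sgraph := SGraph (@clique_sym k) (@clique_irr k).

Definition cyc_adj k (i j : 'I_k) : bool :=
  (i != j) && ((nat_of_ord j == i.+1 %% k) || (nat_of_ord i == j.+1 %% k)).
Lemma cyc_sym k : symmetric (@cyc_adj k).
Proof. by move=> i j; rewrite /cyc_adj eq_sym orbC. Qed.
Lemma cyc_irr k : irreflexive (@cyc_adj k).
Proof. by move=> i; rewrite /cyc_adj eqxx. Qed.
Definition cycle_graph (k : nat) : sgraph := SGraph (@cyc_sym k) (@cyc_irr k).

Definition wheel_adj k (u v : option 'I_k) : bool :=
  match u, v with
  | None, None => false
  | None, Some _ | Some _, None => true
  | Some i, Some j => cyc_adj i j
  end.
Lemma wheel_sym k : symmetric (@wheel_adj k).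
Proof. by case=> [i|] [j|] //=; rewrite cyc_sym. Qed.
Lemma wheel_irr k : irreflexive (@wheel_adj k).
Proof. by case=> [i|] //=; rewrite cyc_irr. Qed.
Definition wheel_graph (k : nat) : sgraph := SGraph (@wheel_sym k) (@wheel_irr k).

(* Vertices: the shared vertices of I (inl), and pairs (x, j) with x ∉ I a
   vertex of H1 and j a vertex of H2, i.e. vertex x of the j-th copy A_j. *)
Section Ltimes.
Variables (H1 : sgraph) (I : {set vtx H1}) (a : vtx H1) (H2 : sgraph).

Definition ltimes_vtx : finType :=
  ({x : vtx H1 | x \in I} + ({x : vtx H1 | x \notin I} * vtx H2))%type.

Definition ltimes_adj (u v : ltimes_vtx) : bool :=
  match u, v with
  | inl x, inl y => adj H1 (val x) (val y)
  | inl x, inr (y, _) => adj H1 (val x) (val y)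
  | inr (x, _), inl y => adj H1 (val x) (val y)
  | inr (x, i), inr (y, j) =>
      ((i == j) && adj H1 (val x) (val y))
      || [&& val x == a, val y == a & adj H2 i j]
  end.

Lemma ltimes_sym : symmetric ltimes_adj.
Proof.
case=> [x|[x i]] [y|[y j]] /=; rewrite ?[adj H1 (sval x) _]adj_sym //.
by rewrite [j == i]eq_sym [adj H2 j i]adj_sym [(sval x == a) && _]andbCA.
Qed.
Lemma ltimes_irr : irreflexive ltimes_adj.
Proof. by case=> [x|[x i]] /=; rewrite ?adj_irr ?andbF. Qed.

Definition ltimes : sgraph := SGraph ltimes_sym ltimes_irr.
End Ltimes.

Definition independent (H : sgraph) (I : {set vtx H}) : Prop :=
  forall x y, x \in I -> y \in I -> ~~ adj H x y.

(* Main.v *)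
Require Import Defs.
From HB Require Import structures.
From mathcomp Require Import all_boot all_order all_algebra.
From mathcomp Require Import reals.
From mathcomp Require Import ring lra zify.
Set Implicit Arguments. Unset Strict Implicit. Unset Printing Implicit Defensive.
Import Order.TTheory GRing.Theory Num.Theory.
Local Open Scope ring_scope.

(** Put c = 1/n and let A be the adjacency kernel.  Local density extends from
sets to weights: p (sum g)^2 - delta <= sum g(x) g(y) A(x,y) whenever 0 <= g <= c.

Cycles.  Feeding the walks of length m from a fixed vertex into this inequality
gives t(C_{2m+1}) >= p a_m - delta, where a_m is the mean of the squared number
of m-walks; Cauchy-Schwarz gives t(C_{2m}) >= a_m, and log-convexity gives
a_m >= a_1^m.  Irregular degrees increase a_1 and hence t(C_k).  If the degrees
are nearly regular and t(C_k) is nearly p^k, the kernel of walks of some fixed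
length is nearly constant in L^1: for even k by a variance computation, for odd k
by perturbing the walk weight in the local density inequality.  Then the kernels
of all longer walks are nearly constant, in particular those of length 2^r, and
r applications of <h,Kh>^2 <= <h,K^2 h> to a centred indicator h give
quasirandomness.

Cliques.  t(K_k) t(K_{k+2}) >= p t(K_{k+1})^2 - delta, so a gain in the edge or
triangle density propagates to all larger cliques.

Wheels.  W_k is a cone over C_k, and in the neighbourhood of v, of density d(v),
the cycle density is at least p^(k-1) T(v) d(v)^(k-2) up to an error, where T(v)
is the triangle density at v.  Irregular degrees give a gain by convexity, and
otherwise the triangle density does.

Products.  For a map phi on I, the extensions of phi to homomorphisms of H_1, two
of them being adjacent when their values at a are, form a locally dense graph
(unless they are few) whose H_2-homomorphisms are the homomorphisms of the product
extending phi.  Apply the KNRS property of H_2 to it and Jensen's inequality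
over phi. *)

(** * Elementary inequalities *)

Section RealInequalities.
Variable R : realFieldType.
Implicit Types x t e p : R.

(** Convexity of powers as a tangent-line bound. The induction step multiplies by [x] and drops the
    nonnegative term (n+1) t^n (x-t)^2. *)
Lemma exprSn_tangent n x t : 0 <= x -> 0 <= t ->
  t ^+ n.+1 + n.+1%:R * t ^+ n * (x - t) <= x ^+ n.+1.
Proof.
move=> x0 t0; elim: n => [|n IHn]; first by rewrite !expr1 expr0; lra.
rewrite [x ^+ _]exprS; apply: le_trans (ler_wpM2l x0 IHn).
rewrite [t ^+ n.+2]exprS [t ^+ n.+1]exprS [n.+2%:R]mulrS.
have := mulr_ge0 (exprn_ge0 n t0) (mulr_ge0 (ler0n R n.+1) (sqr_ge0 (x - t))).
rewrite -subr_ge0 => h; rewrite -subr_ge0.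
apply: le_trans h _; rewrite le_eqVlt; apply/orP; left; apply/eqP; ring.
Qed.

(** The quadratic remainder is what later turns degree variance into a gain for wheels. *)
Lemma exprSSn_tangent n x t : 0 <= x -> 0 <= t ->
  t ^+ n.+2 + n.+2%:R * t ^+ n.+1 * (x - t) + t ^+ n * (x - t) ^+ 2 <= x ^+ n.+2.
Proof.
move=> x0 t0; rewrite [x ^+ _]exprS.
apply: le_trans (ler_wpM2l x0 (exprSn_tangent n x0 t0)).
rewrite [t ^+ n.+2]exprS [t ^+ n.+1]exprS [n.+2%:R]mulrS [n.+1%:R]mulrS.
have h := mulr_ge0 (exprn_ge0 n t0) (mulr_ge0 (ler0n R n) (sqr_ge0 (x - t))).
rewrite -subr_ge0.
apply: le_trans h _; rewrite le_eqVlt; apply/orP; left; apply/eqP; ring.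
Qed.

Lemma exprn_ge_gain n x e : 0 <= x -> 0 <= e ->
  x ^+ n.+1 + x ^+ n * e <= (x + e) ^+ n.+1.
Proof.
move=> x0 e0; rewrite [x ^+ n.+1]exprSr -mulrDr [(x + e) ^+ _]exprSr.
by rewrite ler_wpM2r ?addr_ge0// lerXn2r ?nnegrE ?addr_ge0// lerDl.
Qed.

Lemma exprn_lip n x t e : 0 <= x <= 1 -> 0 <= t <= 1 -> 0 <= e ->
  x <= t + e -> x ^+ n <= t ^+ n + n%:R * e.
Proof.
move=> /andP[x0 x1] /andP[t0 t1] e0 xt.
elim: n => [|n IHn]; first by rewrite !expr0; lra.
rewrite !exprS mulrSr.
have h1 : x * x ^+ n <= x * t ^+ n + n%:R * e.
  have h2 : 0 <= n%:R * e by rewrite mulr_ge0.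
  have := ler_wpM2l x0 IHn; nra.
have tn0 : 0 <= t ^+ n by exact: exprn_ge0.
have tn1 : t ^+ n <= 1 by rewrite exprn_ile1.
have h3 : x * t ^+ n <= (t + e) * t ^+ n by rewrite ler_wpM2r.
have h4 : e * t ^+ n <= e by rewrite ler_piMr.
rewrite mulrDl mul1r; lra.
Qed.

(** Lagrange's identity: the nonnegative double sum in [h] is twice the difference of the two
    sides. *)
Lemma cauchy_schwarz (T : finType) (m f g : T -> R) : (forall i, 0 <= m i) ->
  (\sum_i m i * (f i * g i)) ^+ 2 <=
  (\sum_i m i * f i ^+ 2) * (\sum_i m i * g i ^+ 2).
Proof.
move=> m0.
have h : 0 <= \sum_i \sum_j m i * m j * (f i * g j - f j * g i) ^+ 2.
  by apply: sumr_ge0 => i _; apply: sumr_ge0 => j _; rewrite mulr_ge0 ?sqr_ge0 ?mulr_ge0.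
suff e : \sum_i \sum_j m i * m j * (f i * g j - f j * g i) ^+ 2 =
    (\sum_i m i * f i ^+ 2) * (\sum_i m i * g i ^+ 2) *+ 2
    - (\sum_i m i * (f i * g i)) ^+ 2 *+ 2.
  by move: h; rewrite e; lra.
have e1 : (\sum_i m i * (f i * g i)) ^+ 2 =
   \sum_i \sum_j (m i * (f i * g i)) * (m j * (f j * g j)).
  by rewrite expr2 mulr_suml; apply: eq_bigr => i _; rewrite mulr_sumr.
have e2 : (\sum_i m i * f i ^+ 2) * (\sum_i m i * g i ^+ 2) =
   \sum_i \sum_j (m i * f i ^+ 2) * (m j * g j ^+ 2).
  by rewrite mulr_suml; apply: eq_bigr => i _; rewrite mulr_sumr.
have e3 := e2; rewrite exchange_big /= in e3.
rewrite [in RHS]mulr2n {1}e2 e3 e1 -big_split -sumrMnl -sumrB /=.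
apply: eq_bigr => i _; rewrite -big_split -sumrMnl -sumrB /=.
by apply: eq_bigr => j _; ring.
Qed.

Lemma sqr_sum_le (T : finType) (m f : T -> R) : (forall i, 0 <= m i) ->
  (\sum_i m i * f i) ^+ 2 <= (\sum_i m i) * (\sum_i m i * f i ^+ 2).
Proof.
move=> m0; have := cauchy_schwarz (fun=> 1) f m0.
under eq_bigr do rewrite mul1r.
by under [X in _ <= X * _ -> _]eq_bigr do rewrite expr1n mulr1.
Qed.

(** Log-convexity makes the ratios of consecutive terms nondecreasing; products replace quotients
    because terms may vanish. *)
Lemma log_convex_ratio (a : nat -> R) : (forall j, 0 <= a j) ->
  (forall j, a j.+1 ^+ 2 <= a j * a j.+2) ->
  forall j, a j * a 1 <= a j.+1 * a 0.
Proof.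
move=> a0 ac; elim=> [|j IHj]; first by rewrite mulrC.
have [aj|aj] := ltrP 0 (a j.+1); last first.
  have -> : a j.+1 = 0 by apply/eqP; rewrite eq_le aj a0.
  by rewrite mul0r mulr_ge0.
rewrite -(ler_pM2l aj); have := ler_wpM2r (a0 1) (ac j).
have := ler_wpM2r (a0 j.+2) IHj; rewrite expr2; nra.
Qed.

Lemma log_convex_pow (a : nat -> R) : (forall j, 0 <= a j) ->
  (forall j, a j.+1 ^+ 2 <= a j * a j.+2) -> 0 < a 0 ->
  forall m, a 0 * (a 1 / a 0) ^+ m <= a m.
Proof.
move=> a0 ac h0; elim=> [|m IHm]; first by rewrite expr0 mulr1.
rewrite exprSr mulrA; apply: le_trans (ler_wpM2r _ IHm) _.
  by rewrite divr_ge0 ?a0.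
by rewrite mulrA ler_pdivrMr// log_convex_ratio.
Qed.

Lemma jensen_pow (T : finType) (q y : T -> R) w : (forall i, 0 <= q i) ->
  (forall i, 0 <= y i) -> \sum_i q i = 1 ->
  (\sum_i q i * y i) ^+ w.+1 <= \sum_i q i * y i ^+ w.+1.
Proof.
move=> q0 y0 q1; set t := \sum_i q i * y i.
have t0 : 0 <= t by apply: sumr_ge0 => i _; rewrite mulr_ge0.
(* Tangent at the weighted mean [t]: the linear term averages to zero. *)
apply: (@le_trans _ _
  (\sum_i q i * (t ^+ w.+1 + w.+1%:R * t ^+ w * (y i - t)))); last first.
  by apply: ler_sum => i _; rewrite ler_wpM2l// exprSn_tangent.
under eq_bigr => i _ do
  rewrite mulrDr [q i * (_ * (_ - _))]mulrCA mulrBr mulrBr.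
rewrite big_split /= -mulr_suml q1 mul1r sumrB -!mulr_sumr -/t -mulr_suml q1.
by rewrite mul1r subrr addr0.
Qed.

End RealInequalities.

(** * Weighted walks *)

Section Walks.
Variables (R : realFieldType) (T : finType) (A : T -> T -> R).
Implicit Types (mu g h : T -> R) (p delta c : R).

(** [j] counts interior vertices, so these walks have j+1 edges; the endpoints carry no weight. *)
Fixpoint walk mu (j : nat) (x y : T) : R :=
  if j is i.+1 then \sum_z A x z * mu z * walk mu i z y else A x y.

(** Here [j] counts edges, and every vertex after [x] is weighted. *)
Fixpoint walks_from mu (j : nat) (x : T) : R :=
  if j is i.+1 then \sum_y A x y * mu y * walks_from mu i y else 1.

(** For uniform weights of total mass one and j at least 1, this is the density of the cycle on j+1
    vertices. *)
Definition closed_walks mu j := \sum_x mu x * walk mu j x x.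

Definition walk_moment mu j := \sum_x mu x * walks_from mu j x ^+ 2.

(** Since the error is additive, test weights of arbitrarily small mass are allowed. *)
Definition weighted_dense p delta c := forall g, (forall x, 0 <= g x <= c) ->
  p * (\sum_x g x) ^+ 2 - delta <= \sum_x \sum_y g x * g y * A x y.

Lemma walk_comp mu i j x y :
  \sum_z walk mu i x z * mu z * walk mu j z y = walk mu (i + j).+1 x y.
Proof.
elim: i x => [|i IHi] x //=.
under eq_bigr do rewrite -mulrA mulr_suml.
rewrite exchange_big /=; apply: eq_bigr => z _.
have /= <- := IHi z.
by rewrite mulr_sumr; apply: eq_bigr => t _; rewrite !mulrA.
Qed.

Lemma walk_sum mu j x : \sum_y walk mu j x y * mu y = walks_from mu j.+1 x.
Proof.
elim: j x => [|j IHj] x /=; first by apply: eq_bigr => y _; rewrite mulr1.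
under eq_bigr do rewrite mulr_suml.
rewrite exchange_big /=; apply: eq_bigr => z _.
by have /= <- := IHj z; rewrite mulr_sumr; apply: eq_bigr => t _; rewrite !mulrA.
Qed.

Hypothesis A01 : forall x y, 0 <= A x y <= 1.
Hypothesis Asym : forall x y, A x y = A y x.

Let A0 x y : 0 <= A x y. Proof. by have /andP[] := A01 x y. Qed.
Let A1 x y : A x y <= 1. Proof. by have /andP[] := A01 x y. Qed.

Lemma walk_sym mu j x y : walk mu j x y = walk mu j y x.
Proof.
elim: j x y => [|j IHj] x y; first exact: Asym.
have := walk_comp mu j 0 y x; rewrite addn0 => <- /=.
by apply: eq_bigr => z _; rewrite IHj [A x z]Asym; ring.
Qed.

(** Self-adjointness of the weighted adjacency operator moves one step from one factor to the
    other. *)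
Lemma walks_from_shift mu j :
  \sum_x mu x * (walks_from mu j x * walks_from mu j.+2 x) =
  \sum_x mu x * walks_from mu j.+1 x ^+ 2.
Proof.
have step f : \sum_x mu x * (walks_from mu j x * (\sum_y A x y * mu y * f y)) =
    \sum_y mu y * (walks_from mu j.+1 y * f y).
  under eq_bigr do rewrite mulrA mulr_sumr.
  rewrite exchange_big /=; apply: eq_bigr => y _.
  rewrite [X in _ = _ * X]mulr_suml mulr_sumr; apply: eq_bigr => x _.
  by rewrite [A y x]Asym; ring.
by rewrite [LHS]step; apply: eq_bigr => y _; rewrite expr2.
Qed.

Section Weight.
Variable mu : T -> R.
Hypothesis mu0 : forall x, 0 <= mu x.
Hypothesis mu1 : \sum_x mu x <= 1.

Lemma weighted_avg_bound (f : T -> R) : (forall x, 0 <= f x <= 1) ->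
  0 <= \sum_x mu x * f x <= 1.
Proof.
move=> f01; rewrite sumr_ge0 /=; last first.
  by move=> x _; rewrite mulr_ge0//; have /andP[] := f01 x.
apply: le_trans mu1; apply: ler_sum => x _.
by rewrite ler_piMr//; have /andP[] := f01 x.
Qed.

Lemma walk_bound j x y : 0 <= walk mu j x y <= 1.
Proof.
elim: j x y => [|j IHj] x y //=.
under eq_bigr do rewrite [A x _ * _]mulrC -mulrA.
apply: weighted_avg_bound => z.
have /andP[a b] := IHj z y.
by rewrite mulr_ge0//= -[1]mulr1 ler_pM.
Qed.

Lemma walks_from_bound j x : 0 <= walks_from mu j x <= 1.
Proof.
elim: j x => [|j IHj] x /=; first by rewrite ler01 lexx.
under eq_bigr do rewrite [A x _ * _]mulrC -mulrA.
apply: weighted_avg_bound => z.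
have /andP[a b] := IHj z.
by rewrite mulr_ge0//= -[1]mulr1 ler_pM.
Qed.

Lemma walk_moment_bound j : 0 <= walk_moment mu j <= 1.
Proof.
apply: weighted_avg_bound => x; have /andP[a b] := walks_from_bound j x.
by rewrite sqr_ge0 exprn_ile1.
Qed.

Lemma closed_walks_bound j : 0 <= closed_walks mu j <= 1.
Proof. by apply: weighted_avg_bound => x; exact: walk_bound. Qed.

(** By [walks_from_shift] the middle moment is an inner product of walks of lengths j and j+2, to
    which Cauchy-Schwarz applies. *)
Lemma walk_moment_log_convex j :
  walk_moment mu j.+1 ^+ 2 <= walk_moment mu j * walk_moment mu j.+2.
Proof.
rewrite /walk_moment -walks_from_shift//.
exact: cauchy_schwarz.
Qed.

Lemma walk_moment0 : walk_moment mu 0 = \sum_x mu x.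
Proof. by apply: eq_bigr => x _ /=; rewrite expr1n mulr1. Qed.

Lemma closed_walks_comp i j : closed_walks mu (i + j).+1 =
  \sum_x mu x * \sum_y mu y * (walk mu i x y * walk mu j x y).
Proof.
apply: eq_bigr => x _; rewrite -walk_comp; congr (_ * _).
by apply: eq_bigr => y _; rewrite [walk mu j y x]walk_sym; ring.
Qed.

(** Cutting a closed walk of 2m+2 edges at two opposite vertices gives the square of [walk mu m];
    Cauchy-Schwarz is applied over the second vertex. *)
Lemma even_closed_walks_ge m :
  walk_moment mu m.+1 <= (\sum_x mu x) * closed_walks mu (m + m).+1.
Proof.
rewrite closed_walks_comp mulr_sumr; apply: ler_sum => x _.
rewrite [leRHS]mulrCA ler_wpM2l//.
rewrite -walk_sum; under eq_bigr do rewrite mulrC.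
by under [X in _ <= _ * X]eq_bigr do rewrite -expr2; exact: sqr_sum_le.
Qed.

(** A closed walk of 2m+3 edges is a base vertex [v], its opposite edge, and two walks of m+1 edges
    from [v] to the ends of that edge. The inner double sum has the form to which [weighted_dense]
    applies. *)
Lemma odd_closed_walks m :
  closed_walks mu (m + m).+2 = \sum_v mu v * \sum_x \sum_y
    (mu x * walk mu m v x) * (mu y * walk mu m v y) * A x y.
Proof.
rewrite -addSn closed_walks_comp; apply: eq_bigr => v _; congr (_ * _).
rewrite exchange_big; apply: eq_bigr => y _.
rewrite [walk mu m.+1 v y]walk_sym /= mulr_suml mulr_sumr.
by apply: eq_bigr => x _; rewrite [walk mu m v x]walk_sym [A x y]Asym; ring.
Qed.

Lemma odd_closed_walks_ge p delta c m :
  weighted_dense p delta c -> 0 <= delta -> (forall x, mu x <= c) ->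
  p * walk_moment mu m.+1 - delta <= closed_walks mu (m + m).+2.
Proof.
move=> dense d0 muc; rewrite odd_closed_walks.
apply: (@le_trans _ _ (\sum_v mu v * (p * walks_from mu m.+1 v ^+ 2 - delta))).
  under [in leRHS]eq_bigr do rewrite mulrBr mulrCA.
  rewrite sumrB -mulr_sumr lerD2l lerN2 -mulr_suml.
  by rewrite ler_piMl.
apply: ler_sum => v _; rewrite ler_wpM2l// -walk_sum.
under [X in p * X ^+ 2]eq_bigr do rewrite mulrC.
apply: dense => x; have /andP[a b] := walk_bound m v x.
by rewrite mulr_ge0//=; apply: le_trans (muc x); rewrite ler_piMr.
Qed.

End Weight.
End Walks.

(** * Uniform weights *)

Lemma half_cases k : exists m, k = (m + m)%N \/ k = (m + m).+1.
Proof.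
exists k./2; rewrite addnn -{1 3}(odd_double_half k).
by case: (odd k); [right|left].
Qed.

(** Meant for [mu] concentrated on a neighbourhood, of mass possibly below one. One edge-density
    factor is kept instead of being bounded through density, so that triangle information survives.
    The error is s^2 so that dividing it by a mass of at least [s] costs only [s]. *)
Lemma closed_walks_ge (R : realFieldType) (T : finType) (A : T -> T -> R)
    (mu : T -> R) (p s c : R) k :
  (forall x y, 0 <= A x y <= 1) -> (forall x y, A x y = A y x) ->
  (forall x, 0 <= mu x <= c) -> \sum_x mu x <= 1 ->
  0 < p < 1 -> 0 < s <= 1 -> weighted_dense A p (s ^+ 2) c ->
  p ^+ k.+1 * (\sum_x \sum_y mu x * mu y * A x y) * (\sum_x mu x) ^+ k
    - k.+2%:R * s <= closed_walks A mu k.+1.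
Proof.
move=> A01 Asym muc mu1 /andP[p0 p1] /andP[s0 s1] dense.
have mu0 x : 0 <= mu x by have /andP[] := muc x.
have muc' x : mu x <= c by have /andP[] := muc x.
set phi := \sum_x mu x; set t := \sum_x \sum_y _.
have et : t = \sum_x mu x * walks_from A mu 1 x.
  apply: eq_bigr => x _ /=; rewrite mulr_sumr; apply: eq_bigr => y _; ring.
have phi0 : 0 <= phi by exact: sumr_ge0.
have t0 : 0 <= t.
  by rewrite et sumr_ge0// => x _; rewrite mulr_ge0//; have /andP[] := walks_from_bound A01 mu0 mu1 1 x.
have tphi : t <= phi.
  rewrite et; apply: ler_sum => x _; rewrite ler_piMr//.
  by have /andP[] := walks_from_bound A01 mu0 mu1 1 x.
have pphi0 : 0 <= p * phi by rewrite mulr_ge0// ltW.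
have pphi1 : p * phi <= 1 by rewrite -[1]mulr1 ler_pM// ltW.
have /andP[C0 _] := closed_walks_bound A01 mu0 mu1 k.+1.
have pk0 : 0 <= p ^+ k.+1 by rewrite exprn_ge0// ltW.
have pk1 : p ^+ k.+1 <= 1 by rewrite exprn_ile1// ltW.
have phik0 : 0 <= phi ^+ k by rewrite exprn_ge0.
have phik1 : phi ^+ k <= 1 by rewrite exprn_ile1.
(* For mass below [s] the main term is itself below [s]. *)
have [phis|phis] := ltrP phi s.
  apply: le_trans C0; rewrite subr_le0.
  apply: (@le_trans _ _ s); last by rewrite ler_peMl ?ltW// ltr1n.
  apply: (@le_trans _ _ t); last by rewrite (le_trans tphi)// ltW.
  by rewrite mulrAC ler_piMl// -[1]mulr1 ler_pM.
have phip : 0 < phi by exact: lt_le_trans phis.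
(* [u] is the average over [mu] of the degrees inside [mu]; density bounds it below by [p * phi] up
   to [s]. *)
set u := t / phi.
have u0 : 0 <= u by rewrite divr_ge0.
have u1 : u <= 1 by rewrite ler_pdivrMr// mul1r.
have tE : t = u * phi by rewrite /u mulfVK// gt_eqF.
have pu : p * phi <= u + s.
  have := dense mu muc; rewrite -/phi -/t => ld.
  rewrite -(ler_pM2r phip) mulrDl -tE; nra.
have a0E : walk_moment A mu 0 = phi by exact: walk_moment0.
have moment0 j : 0 <= walk_moment A mu j.
  by have /andP[] := walk_moment_bound A01 mu0 mu1 j.
have au : u ^+ 2 <= walk_moment A mu 1 / phi.
  rewrite ler_pdivlMr// -(ler_pM2l phip).
  have := sqr_sum_le (walks_from A mu 1) mu0; rewrite -et -/phi.
  apply: le_trans; rewrite tE le_eqVlt; apply/orP; left; apply/eqP; ring.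
have am m : phi * u ^+ m.*2 <= walk_moment A mu m.
  have := log_convex_pow moment0 (walk_moment_log_convex Asym mu0).
  rewrite a0E => /(_ phip m); apply: le_trans.
  by rewrite ler_wpM2l// -mul2n exprM lerXn2r ?nnegrE ?sqr_ge0// (le_trans _ au)// sqr_ge0.
(* Factors [u] are traded for [p * phi] at cost [s] each; one [u] is kept to restore [t]. *)
have lip j : (p * phi) ^+ j - j%:R * s <= u ^+ j.
  by rewrite lerBlDr exprn_lip ?pphi0 ?u0// ltW.
have -> : p ^+ k.+1 * t * phi ^+ k = p ^+ k.+1 * phi ^+ k.+1 * u.
  by rewrite tE exprSr [phi ^+ k.+1]exprSr; ring.
have [m [km|km]] := half_cases k.
- have hC : u ^+ k.+2 <= closed_walks A mu k.+1.
    rewrite -(ler_pM2l phip) {2}km; apply: le_trans (even_closed_walks_ge Asym mu0 m).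
    by apply: le_trans (am m.+1); rewrite km -addnn addnS.
  apply: le_trans hC; rewrite [u ^+ _]exprSr -exprMn.
  apply: le_trans (ler_wpM2r u0 (lip k.+1)).
  rewrite mulrBl lerD2l lerN2 mulrC.
  have : k.+1%:R * s <= k.+2%:R * s by rewrite ler_wpM2r ?ler_nat// ltW.
  by apply: le_trans; rewrite ler_piMl// mulr_ge0// ltW.
- have hC : p * phi * u ^+ k.+1 - s ^+ 2 <= closed_walks A mu k.+1.
    rewrite {2}km; apply: le_trans (odd_closed_walks_ge A01 Asym mu0 mu1 m dense _ muc'); last exact: sqr_ge0.
    rewrite lerD2r -mulrA ler_wpM2l ?(ltW p0)//; apply: le_trans (am m.+1).
    by rewrite km -addnn addnS.
  apply: le_trans hC; rewrite [u ^+ _]exprS mulrA -exprMn exprS.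
  have h := ler_wpM2l (mulr_ge0 pphi0 u0) (lip k).
  have s2 : s ^+ 2 <= s by rewrite expr2 ler_piMl// ltW.
  have ks : 0 <= k%:R * s by rewrite mulr_ge0// ltW.
  have h2 : p * phi * u * (k%:R * s) <= k%:R * s.
    by rewrite ler_piMl// -[1]mulr1 ler_pM.
  rewrite !mulrSr.
  rewrite mulrBr in h; rewrite !mulrDl !mul1r.
  rewrite [_ * _ ^+ k * u]mulrAC; nra.
Qed.

Section Uniform.
Variables (R : realFieldType) (T : finType) (A : T -> T -> R) (c : R).
Hypothesis A01 : forall x y, 0 <= A x y <= 1.
Hypothesis Asym : forall x y, A x y = A y x.
Hypothesis c0 : 0 <= c.
Hypothesis c1 : \sum_(x : T) c = 1.
Implicit Types (p sigma rho kappa : R).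

Let A0 x y : 0 <= A x y. Proof. by have /andP[] := A01 x y. Qed.
Let A1 x y : A x y <= 1. Proof. by have /andP[] := A01 x y. Qed.
Local Notation mu := (fun=> c).

Lemma avg_const (t : R) : \sum_(x : T) c * t = t.
Proof. by rewrite -mulr_suml c1 mul1r. Qed.

Lemma avg_le_const (f : T -> R) t : (forall x, f x <= t) -> \sum_x c * f x <= t.
Proof.
by move=> ft; rewrite -[leRHS]avg_const; apply: ler_sum => x _; rewrite ler_wpM2l.
Qed.

Lemma avg_norm (f : T -> R) : `|\sum_x c * f x| <= \sum_x c * `|f x|.
Proof.
apply: le_trans (ler_norm_sum _ _ _) _.
by apply: ler_sum => x _; rewrite normrM ger0_norm.
Qed.

Definition degree_defect p := \sum_x c * `|walks_from A mu 1 x - p|.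

Definition walk_defect p j :=
  \sum_x c * \sum_y c * `|walk A mu j x y - p ^+ j.+1|.

(** Split [f] into the constant [t] and a deviation: the constant sees only the degree of [x], and
    the deviation is bounded in L^1 because [A] is at most 1. *)
Lemma neighbour_avg_near (f : T -> R) (t p : R) x :
  `|\sum_y A x y * c * f y - p * t| <=
  \sum_y c * `|f y - t| + `|t| * `|walks_from A mu 1 x - p|.
Proof.
have -> : \sum_y A x y * c * f y - p * t =
    \sum_y c * (A x y * (f y - t)) + t * (walks_from A mu 1 x - p).
  rewrite /= mulrBr mulr_sumr addrA -big_split /= [p * t]mulrC; congr (_ - _).
  by apply: eq_bigr => y _; ring.
apply: le_trans (ler_normD _ _) _; rewrite normrM lerD2r.
apply: le_trans (avg_norm _) _.
apply: ler_sum => y _; rewrite ler_wpM2l// normrM ger0_norm//.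
by rewrite ler_piMl.
Qed.

Lemma walks_from_near p sigma j : 0 <= p <= 1 -> degree_defect p <= sigma ->
  \sum_x c * `|walks_from A mu j x - p ^+ j| <= j%:R * sigma.
Proof.
move=> /andP[p0 p1] ds; elim: j => [|j IHj].
  by rewrite mul0r sumr_le0// => x _ /=; rewrite expr0 subrr normr0 mulr0.
apply: (@le_trans _ _ (\sum_x c * (j%:R * sigma + `|walks_from A mu 1 x - p|))).
  apply: ler_sum => x _; rewrite ler_wpM2l// exprS.
  apply: le_trans (neighbour_avg_near _ _ _ _) _; rewrite lerD//.
  by rewrite ler_piMl// ger0_norm ?exprn_ge0// exprn_ile1.
under eq_bigr do rewrite mulrDr.
by rewrite big_split /= avg_const mulrSr mulrDl mul1r lerD2l.
Qed.

Lemma walk_defect_exchange p j :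
  walk_defect p j = \sum_y c * \sum_x c * `|walk A mu j x y - p ^+ j.+1|.
Proof.
rewrite /walk_defect; under eq_bigr do rewrite mulr_sumr.
by rewrite exchange_big; apply: eq_bigr => y _; rewrite mulr_sumr.
Qed.

(** Prepending an edge averages the kernel over neighbours, so near-constancy persists up to an
    extra degree defect. *)
Lemma walk_defect_step p sigma j : 0 <= p <= 1 -> degree_defect p <= sigma ->
  walk_defect p j.+1 <= walk_defect p j + sigma.
Proof.
move=> /andP[p0 p1] ds; rewrite !walk_defect_exchange -[sigma]avg_const.
rewrite -big_split; apply: ler_sum => y _; rewrite [leRHS]/= -mulrDr ler_wpM2l//.
apply: (@le_trans _ _ (\sum_x c * (\sum_z c * `|walk A mu j z y - p ^+ j.+1|
    + `|walks_from A mu 1 x - p|))).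
  apply: ler_sum => x _; rewrite ler_wpM2l// exprS.
  apply: le_trans (neighbour_avg_near _ _ _ _) _; rewrite lerD//.
  by rewrite ler_piMl// ger0_norm ?exprn_ge0// exprn_ile1.
under [leLHS]eq_bigr do rewrite mulrDr.
by rewrite big_split /= avg_const lerD2l.
Qed.

Lemma walk_defect_steps p sigma j i : 0 <= p <= 1 -> degree_defect p <= sigma ->
  walk_defect p (j + i) <= walk_defect p j + i%:R * sigma.
Proof.
move=> p01 ds; elim: i => [|i IHi]; first by rewrite addn0 mul0r addr0.
rewrite addnS; apply: le_trans (walk_defect_step _ p01 ds) _.
by rewrite mulrSr mulrDl mul1r addrA lerD2r.
Qed.

(** * Cut estimates from near-constant walk kernels *)

Section Cut.
Variable h : T -> R.
Hypothesis h1 : forall x, `|h x| <= 1.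
Hypothesis h_sum : \sum_x c * h x = 0.

Let form j := \sum_x c * (h x * \sum_y c * (walk A mu j x y * h y)).

(** Cauchy-Schwarz against [h], of L^2 norm at most 1; the squared norm of the image of [h] is the
    form of the composed kernel, by symmetry. *)
Lemma centred_form_sqr j : form j ^+ 2 <= form (j + j).+1.
Proof.
have h2 : \sum_x c * h x ^+ 2 <= 1.
  by apply: avg_le_const => x; rewrite -real_normK ?num_real// exprn_ile1.
apply: le_trans (cauchy_schwarz _ _ (fun=> c0)) _.
apply: (@le_trans _ _ (\sum_x c * (\sum_y c * (walk A mu j x y * h y)) ^+ 2)).
  by rewrite ler_piMl// sumr_ge0// => x _; rewrite mulr_ge0// sqr_ge0.
rewrite /form le_eqVlt; apply/orP; left; apply/eqP.
under eq_bigr do rewrite expr2 mulr_suml mulr_sumr.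
rewrite exchange_big; apply: eq_bigr => y _.
under eq_bigr do rewrite mulr_sumr mulr_sumr.
rewrite exchange_big; rewrite mulr_sumr mulr_sumr; apply: eq_bigr => z _.
rewrite -(walk_comp A mu) mulr_suml !mulr_sumr; apply: eq_bigr => x _.
by rewrite [walk A mu j y x](walk_sym Asym); ring.
Qed.

(** As [h] has mean zero, subtracting the constant p^(j+1) from the kernel leaves the form
    unchanged. *)
Lemma centred_form_le p j : `|form j| <= walk_defect p j.
Proof.
have -> : form j = \sum_x c * \sum_y c *
    (h x * (walk A mu j x y - p ^+ j.+1) * h y).
  apply: eq_bigr => x _; congr (_ * _).
  have -> : \sum_y c * (h x * (walk A mu j x y - p ^+ j.+1) * h y) =
      h x * (\sum_y c * (walk A mu j x y * h y)) - h x * p ^+ j.+1 * \sum_y c * h y.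
    by rewrite !mulr_sumr -sumrB; apply: eq_bigr => y _; ring.
  by rewrite h_sum mulr0 subr0.
apply: le_trans (avg_norm _) _; apply: ler_sum => x _; rewrite ler_wpM2l//.
apply: le_trans (avg_norm _) _; apply: ler_sum => y _; rewrite ler_wpM2l//.
rewrite !normrM -[leRHS]mulr1 ler_pM ?mulr_ge0// ler_piMl//.
Qed.

(** Repeated squaring; index [(2 ^ r).-1] is the kernel of walks with 2^r edges. *)
Lemma centred_form_pow r : `|form 0| ^+ (2 ^ r) <= `|form (2 ^ r).-1|.
Proof.
elim: r => [|r IHr]; first by rewrite expr1.
rewrite expnS mulnC exprM.
apply: le_trans (_ : `|form (2 ^ r).-1| ^+ 2 <= _).
  by rewrite lerXn2r ?nnegrE ?exprn_ge0.
rewrite real_normK ?num_real//; apply: le_trans (centred_form_sqr _) _.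
apply: le_trans (ler_norm _) _; suff -> : ((2 ^ r).-1 + (2 ^ r).-1).+1 = (2 ^ r * 2).-1 by [].
by rewrite muln2 -addnn; case: (2 ^ r)%N (expn_gt0 2 r) => //= n _; rewrite addnS.
Qed.

End Cut.

Lemma cut_close p sigma rho kappa M (S : {set T}) :
  0 <= p <= 1 -> degree_defect p <= sigma -> walk_defect p M <= rho ->
  0 <= kappa -> rho + (2 ^ M)%:R * sigma <= kappa ^+ (2 ^ M) ->
  `|\sum_(x in S) \sum_(y in S) c * c * A x y - p * (\sum_(x in S) c) ^+ 2|
    <= kappa + 3%:R * sigma.
Proof.
move=> p01 ds dM k0 hk; set s := \sum_(x in S) c.
have sE : s = \sum_x c * (x \in S)%:R.
  by rewrite /s big_mkcond; apply: eq_bigr => x _; case: (x \in S); rewrite ?mulr1 ?mulr0.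
have s01 : 0 <= s <= 1.
  rewrite sE sumr_ge0/=; last by move=> x _; rewrite mulr_ge0.
  by apply: avg_le_const => x; rewrite lern1 leq_b1.
have sigma0 : 0 <= sigma.
  by apply: le_trans ds; apply: sumr_ge0 => x _; rewrite mulr_ge0.
(* The indicator of [S], centred by its measure [s]. *)
pose h x := (x \in S)%:R - s.
have h1 x : `|h x| <= 1.
  by have /andP[s0 s1] := s01; rewrite ler_norml /h; case: (x \in S) => /=; lra.
have h_sum : \sum_x c * h x = 0.
  by under eq_bigr do rewrite mulrBr; rewrite sumrB -sE avg_const subrr.
set form0 := \sum_x c * (h x * \sum_y c * (A x y * h y)).
have form_small : `|form0| <= kappa.
  rewrite -(@ler_pXn2r _ (2 ^ M)) ?nnegrE ?expn_gt0//.
  have := centred_form_pow h1 M; rewrite -/form0 => /le_trans; apply.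
  apply: le_trans (centred_form_le h1 h_sum p _) _.
  (* Taking 2^M edges makes the walk long enough to be reached from index [M] by prepending fewer
     than 2^M edges. *)
  have M2 : (M <= (2 ^ M).-1)%N by rewrite -ltnS prednK ?expn_gt0// ltn_expl.
  rewrite -(subnKC M2); apply: le_trans (walk_defect_steps _ _ p01 ds) _.
  apply: le_trans hk; rewrite lerD// ler_wpM2r// ler_nat.
  by rewrite (leq_trans (leq_subr _ _))// leq_pred.
(* Expand the form at the indicator h + s. The cross terms account for 2 sigma and the constant term
   for one more, hence the 3 sigma. *)
have -> : \sum_(x in S) \sum_(y in S) c * c * A x y =
    form0 + 2%:R * s * (\sum_x c * (h x * (walks_from A mu 1 x - p))) +
    s ^+ 2 * \sum_x c * walks_from A mu 1 x.
  have -> : \sum_x c * (h x * (walks_from A mu 1 x - p)) =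
      \sum_x c * (h x * walks_from A mu 1 x).
    under eq_bigr do rewrite mulrBr mulrBr mulrA.
    rewrite sumrB /=; under [X in _ - X]eq_bigr do rewrite mulrA.
    by rewrite -mulr_suml h_sum mul0r subr0; apply: eq_bigr => x _; rewrite mulrA.
  have e1 : \sum_(x in S) \sum_(y in S) c * c * A x y =
      \sum_x \sum_y c * c * A x y * ((x \in S)%:R * (y \in S)%:R).
    rewrite big_mkcond; apply: eq_bigr => x _; case: (x \in S); last first.
      by rewrite big1// => y _; rewrite mul0r mulr0.
    rewrite big_mkcond; apply: eq_bigr => y _; rewrite mul1r.
    by case: (y \in S); rewrite ?mulr1 ?mulr0.
  have e2 : form0 = \sum_x \sum_y c * c * A x y * (h x * h y).
    apply: eq_bigr => x _; rewrite !mulr_sumr; apply: eq_bigr => y _; ring.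
  have e3 : \sum_x c * (h x * walks_from A mu 1 x) =
      \sum_x \sum_y c * c * A x y * h x.
    by apply: eq_bigr => x _ /=; rewrite !mulr_sumr; apply: eq_bigr => y _; ring.
  have e4 : \sum_x c * (h x * walks_from A mu 1 x) =
      \sum_x \sum_y c * c * A x y * h y.
    rewrite e3 exchange_big; apply: eq_bigr => x _; apply: eq_bigr => y _.
    by rewrite Asym.
  have e5 : \sum_x c * walks_from A mu 1 x = \sum_x \sum_y c * c * A x y.
    by apply: eq_bigr => x _ /=; rewrite !mulr_sumr; apply: eq_bigr => y _; ring.
  rewrite mulrAC mulrDl mul1r mulrDl {1}e3 e4 e1 e2 e5 !mulr_suml mulr_sumr.
  rewrite -!big_split; apply: eq_bigr => x _; rewrite !mulr_suml mulr_sumr.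
  by rewrite -!big_split; apply: eq_bigr => y _; rewrite /h /=; ring.
set hd := \sum_x _; set P := \sum_x _.
have hd_small : `|hd| <= sigma.
  apply: le_trans ds; apply: le_trans (avg_norm _) _; apply: ler_sum => x _.
  by rewrite ler_wpM2l// normrM ler_piMl.
have P_near : `|P - p| <= sigma.
  have -> : P - p = \sum_x c * (walks_from A mu 1 x - p).
    by under eq_bigr do rewrite mulrBr; rewrite sumrB avg_const.
  exact: le_trans (avg_norm _) ds.
have -> : form0 + 2%:R * s * hd + s ^+ 2 * P - p * s ^+ 2 =
    form0 + (2%:R * s * hd + s ^+ 2 * (P - p)) by ring.
apply: le_trans (ler_normD _ _) _; rewrite lerD//.
have -> : 3%:R * sigma = 2%:R * sigma + sigma by ring.
move: s01 => /andP[s0 s1].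
apply: le_trans (ler_normD _ _) _; rewrite !normrM; apply: lerD.
  rewrite normr_nat (ger0_norm s0) -mulrA ler_wpM2l//.
  by apply: le_trans hd_small; rewrite ler_piMl.
by apply: le_trans P_near; rewrite (ger0_norm s0) ler_piMl// -[leRHS]mulr1 ler_pM.
Qed.

End Uniform.

(** * Degree variance and walk defects in dense kernels *)

Section DenseUniform.
Variables (R : realFieldType) (T : finType) (A : T -> T -> R) (c : R).
Hypothesis A01 : forall x y, 0 <= A x y <= 1.
Hypothesis Asym : forall x y, A x y = A y x.
Hypothesis c0 : 0 <= c.
Hypothesis c1 : \sum_(x : T) c = 1.
Implicit Types (p sigma rho kappa delta theta b : R).

Let A0 x y : 0 <= A x y. Proof. by have /andP[] := A01 x y. Qed.
Let A1 x y : A x y <= 1. Proof. by have /andP[] := A01 x y. Qed.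
Let c1' : \sum_(x : T) c <= 1. Proof. by rewrite c1. Qed.
Local Notation mu := (fun=> c).
Local Notation deg := (walks_from A mu 1).

Definition degree_variance p := \sum_x c * (deg x - p) ^+ 2.

Lemma degree_defect_le p sigma : 0 <= sigma ->
  degree_variance p <= sigma ^+ 2 -> degree_defect A c p <= sigma.
Proof.
move=> s0 h; rewrite -(@ler_pXn2r _ 2) ?nnegrE//; last first.
  by apply: sumr_ge0 => x _; rewrite mulr_ge0.
apply: le_trans h; apply: le_trans (sqr_sum_le _ (fun=> c0)) _.
by rewrite c1 mul1r; under eq_bigr do rewrite real_normK ?num_real//.
Qed.

Lemma edge_density_ge p delta : weighted_dense A p delta c ->
  p - delta <= \sum_x c * deg x.
Proof.
move=> /(_ mu); rewrite c1 expr1n mulr1 => /(_ _)/le_trans; apply.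
  by move=> x; rewrite c0 lexx.
by apply: ler_sum => x _ /=; rewrite mulr_sumr; apply: ler_sum => y _;
  rewrite mulr1 le_eqVlt; apply/orP; left; apply/eqP; ring.
Qed.

(** Expanding the degree variance about [p] leaves a linear term, which the lower bound on edge
    density controls. *)
Lemma walk_moment1_ge p delta : 0 <= p <= 1 -> 0 <= delta ->
  weighted_dense A p delta c ->
  p ^+ 2 + degree_variance p - 2%:R * delta <= walk_moment A mu 1.
Proof.
move=> /andP[p0 p1] d0 /edge_density_ge ed.
have -> : degree_variance p =
    walk_moment A mu 1 - 2%:R * p * (\sum_x c * deg x) + p ^+ 2.
  rewrite /degree_variance /walk_moment -[p ^+ 2](avg_const c1) mulr_sumr.
  by rewrite -sumrB -big_split; apply: eq_bigr => x _; rewrite /=; ring.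
have := ler_wpM2l p0 ed; have := ler_wpM2r d0 p1; nra.
Qed.

Lemma closed_walks_irregular p delta sigma k : 0 < p < 1 -> 0 <= delta ->
  0 < sigma <= 1 -> weighted_dense A p delta c ->
  delta <= p ^+ k.+3 * sigma ^+ 2 / 8%:R ->
  sigma ^+ 2 <= degree_variance p ->
  p ^+ k.+3 + p ^+ k.+3 * sigma ^+ 2 / 8%:R < closed_walks A mu k.+2.
Proof.
move=> /andP[p0 p1] d0 /andP[s0 s1] dense dle irr.
set g := p ^+ k.+3 * sigma ^+ 2 in dle *.
have moment0 j : 0 <= walk_moment A mu j.
  by have /andP[] := walk_moment_bound A01 (fun=> c0) c1' j.
have a0E : walk_moment A mu 0 = 1 by rewrite walk_moment0.
have am m : walk_moment A mu 1 ^+ m <= walk_moment A mu m.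
  have := log_convex_pow moment0 (walk_moment_log_convex Asym (fun=> c0)).
  by rewrite a0E divr1 => /(_ ltr01 m); rewrite mul1r.
have p01 : 0 <= p <= 1 by rewrite !ltW.
have ppow j : 0 < p ^+ j by exact: exprn_gt0.
have ppow1 j : p ^+ j <= 1 by rewrite exprn_ile1// ltW.
have s2 : 0 < sigma ^+ 2 by exact: exprn_gt0.
have gs : g <= sigma ^+ 2 by rewrite ler_piMl// ltW.
(* The bound on [delta] gives delta <= sigma^2 / 8, so the loss 2 delta uses at most half of the
   variance. *)
have a1 : p ^+ 2 + sigma ^+ 2 / 2%:R <= walk_moment A mu 1.
  apply: le_trans (walk_moment1_ge p01 d0 dense); lra.
have gain m : p ^+ m.*2.+2 + p ^+ m.*2 * (sigma ^+ 2 / 2%:R) <=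
    walk_moment A mu m.+1.
  apply: le_trans (am m.+1).
  rewrite -doubleS -!mul2n !exprM; apply: le_trans (exprn_ge_gain _ _ _) _.
  - by rewrite sqr_ge0.
  - by rewrite divr_ge0// ltW.
  rewrite lerXn2r ?nnegrE//.
  by rewrite addr_ge0 ?sqr_ge0 ?divr_ge0// ltW.
have g0 : 0 < g by exact: mulr_gt0.
(* As p < 1, [g] is below the gain produced for either parity of the cycle. *)
have gle j : (j <= k.+3)%N -> g <= p ^+ j * sigma ^+ 2.
  by move=> jk; rewrite ler_wpM2r ?(ltW s2)// ler_wiXn2l ?(ltW p0) ?(ltW p1).
have [m [km|km]] := half_cases k.
- have := odd_closed_walks_ge A01 Asym (fun=> c0) c1' m dense d0 (fun=> lexx _).
  rewrite -km; have := gain m; rewrite -addnn -km => h1 h2; apply: lt_le_trans h2.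
  have := ler_wpM2l (ltW p0) h1; have := gle k.+1 (leq_addl 2 _).
  rewrite [p ^+ k.+3]exprS [p ^+ k.+1]exprS; lra.
- have := even_closed_walks_ge Asym (fun=> c0) m.+1; rewrite c1 mul1r.
  have -> : (m.+1 + m.+1).+1 = k.+2 by rewrite km addnS addSn.
  have := gain m.+1; rewrite -addnn.
  have -> : (m.+1 + m.+1)%N = k.+1 by rewrite km addnS addSn.
  move=> h1 h2; apply: lt_le_trans h2; apply: lt_le_trans h1.
  have := gle k.+1 (leq_addl 2 _); lra.
Qed.

Lemma walks_near_sum p sigma m : 0 <= p <= 1 ->
  degree_defect A c p <= sigma ->
  `|\sum_x c * walks_from A mu m x - p ^+ m| <= m%:R * sigma.
Proof.
move=> p01 ds.
have -> : \sum_x c * walks_from A mu m x - p ^+ m =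
    \sum_x c * (walks_from A mu m x - p ^+ m).
  by under [RHS]eq_bigr do rewrite mulrBr; rewrite sumrB avg_const.
apply: le_trans (avg_norm c0 _) _; exact: walks_from_near.
Qed.

(** The closed walks are the second moment of the kernel and near-regularity fixes its mean, so a
    small excess means small variance. Cauchy-Schwarz passes from L^2 to L^1. *)
Lemma even_walk_defect p sigma eps m : 0 <= p <= 1 ->
  degree_defect A c p <= sigma ->
  closed_walks A mu (m + m).+1 <= p ^+ m.+1 ^+ 2 + eps ->
  walk_defect A c p m ^+ 2 <= eps + 2%:R * m.+1%:R * sigma.
Proof.
move=> p01 ds hC; have /andP[p0 p1] := p01.
apply: le_trans (sqr_sum_le _ (fun=> c0)) _; rewrite c1 mul1r.
apply: (@le_trans _ _ (\sum_x c * \sum_y c * (walk A mu m x y - p ^+ m.+1) ^+ 2)).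
  apply: ler_sum => x _; rewrite ler_wpM2l//.
  apply: le_trans (sqr_sum_le _ (fun=> c0)) _; rewrite c1 mul1r.
  by under eq_bigr do rewrite real_normK ?num_real//.
have -> : \sum_x c * \sum_y c * (walk A mu m x y - p ^+ m.+1) ^+ 2 =
    closed_walks A mu (m + m).+1
    - 2%:R * p ^+ m.+1 * (\sum_x c * walks_from A mu m.+1 x) + p ^+ m.+1 ^+ 2.
  rewrite closed_walks_comp// -[X in _ = _ + X](avg_const c1) mulr_sumr.
  rewrite -sumrB -big_split; apply: eq_bigr => x _.
  rewrite -walk_sum -[X in _ = _ + c * X](avg_const c1) /= !mulr_sumr.
  by rewrite -sumrB -big_split; apply: eq_bigr => y _; rewrite /=; ring.
have := walks_near_sum m.+1 p01 ds; rewrite ler_norml => /andP[h _].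
have q0 : 0 <= p ^+ m.+1 by rewrite exprn_ge0.
have q1 : p ^+ m.+1 <= 1 by rewrite exprn_ile1.
have e0 : 0 <= m.+1%:R * sigma.
  rewrite mulr_ge0//; apply: le_trans ds; apply: sumr_ge0 => x _.
  by rewrite mulr_ge0.
set q := p ^+ m.+1 in q0 q1 h hC *; set e := _ * sigma in h e0 *.
rewrite -[2%:R * _ * sigma]mulrA -/e; nra.
Qed.

(** Perturb the walk weight [g] by b times the weight [h] of the set where the next kernel falls
    short of p^(m+2), and test density. The term linear in [b] is the shortfall; the quadratic one
    costs at most b^2. *)
Lemma odd_walk_deficit p delta b m v : 0 <= p <= 1 -> 0 <= b <= 1 ->
  weighted_dense A p delta c ->
  2%:R * b * (\sum_x c * Num.max 0 (p ^+ m.+2 - walk A mu m.+1 v x)) <=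
  2%:R * b * `|walks_from A mu m.+1 v - p ^+ m.+1| + b ^+ 2 + 4%:R * delta
  + \sum_x \sum_y (c * walk A mu m v x) * (c * walk A mu m v y) * A x y
  - p * walks_from A mu m.+1 v ^+ 2.
Proof.
move=> /andP[p0 p1] /andP[b0 b1] dense.
pose g x := c * walk A mu m v x.
pose h x := c * (walk A mu m.+1 v x < p ^+ m.+2)%R%:R.
have h0 x : 0 <= h x by rewrite mulr_ge0.
have hc x : h x <= c by rewrite ler_piMr// lern1 leq_b1.
have w01 x : 0 <= walk A mu m v x <= 1 by exact: walk_bound.
have g0 x : 0 <= g x by rewrite mulr_ge0//; have /andP[] := w01 x.
have gc x : g x <= c by rewrite ler_piMr//; have /andP[] := w01 x.
(* Halving keeps the test weight below [c]; quadratic homogeneity turns [delta] into 4 delta. *)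
have := dense (fun x => (g x + b * h x) / 2%:R).
have -> : \sum_x (g x + b * h x) / 2%:R =
    (walks_from A mu m.+1 v + b * \sum_x h x) / 2%:R.
  rewrite -walk_sum -mulr_suml big_split /=; congr ((_ + _) / _); last by rewrite mulr_sumr.
  by apply: eq_bigr => x _; rewrite mulrC.
set w := walks_from A mu m.+1 v; set H := \sum_x h x.
set Qgg := \sum_x \sum_y (c * walk A mu m v x) * (c * walk A mu m v y) * A x y.
have H0 : 0 <= H by exact: sumr_ge0.
have H1 : H <= 1 by rewrite -c1; apply: ler_sum.
pose Qgh := \sum_x h x * walk A mu m.+1 v x.
pose Qhh := \sum_x \sum_y h x * h y * A x y.
have Qhh1 : Qhh <= 1.
  apply: (@le_trans _ _ (\sum_x h x * H)).
    apply: ler_sum => x _; rewrite mulr_sumr; apply: ler_sum => y _.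
    by rewrite ler_piMr// mulr_ge0.
  by rewrite -mulr_suml -/H -[leRHS]mulr1 ler_pM.
have -> : \sum_x \sum_y (g x + b * h x) / 2%:R * ((g y + b * h y) / 2%:R) * A x y
    = (Qgg + 2%:R * b * Qgh + b ^+ 2 * Qhh) / 4%:R.
  have e1 : Qgh = \sum_x \sum_y h x * g y * A x y.
    apply: eq_bigr => x _; rewrite walk_sym//= mulr_sumr; apply: eq_bigr => y _.
    by rewrite [walk A _ m y v]walk_sym// /g; ring.
  have e2 : Qgh = \sum_x \sum_y g x * h y * A x y.
    rewrite e1 exchange_big; apply: eq_bigr => x _; apply: eq_bigr => y _.
    by rewrite [A y x]Asym; ring.
  have -> : 2%:R * b * Qgh = b * Qgh + b * Qgh by ring.
  rewrite {1}e1 e2 /Qgg /Qhh !mulr_sumr -!big_split mulr_suml /=.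
  apply: eq_bigr => x _; rewrite !mulr_sumr -!big_split mulr_suml /=.
  by apply: eq_bigr => y _; rewrite /g; field.
have -> : \sum_x c * Num.max 0 (p ^+ m.+2 - walk A mu m.+1 v x) = p ^+ m.+2 * H - Qgh.
  rewrite mulr_sumr -sumrB; apply: eq_bigr => x _; rewrite /h.
  case: ltrP => hx; first by rewrite max_r ?subr_ge0 ?ltW//=; ring.
  by rewrite max_l ?subr_le0//=; ring.
have gh x : 0 <= (g x + b * h x) / 2%:R <= c.
  have bh : b * h x <= c by apply: le_trans (hc x); rewrite ler_piMl.
  have bh0 : 0 <= b * h x by rewrite mulr_ge0.
  by move: (g0 x) (gc x) => *; apply/andP; split; lra.
move=> /(_ gh) ld.
have dev : (p ^+ m.+2 - p * w) * H <= `|w - p ^+ m.+1|.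
  rewrite exprS -mulrBr; apply: le_trans (ler_norm _) _.
  rewrite !normrM distrC -[leRHS]mulr1 ler_pM//; last by rewrite ger0_norm.
    by rewrite mulr_ge0.
  by rewrite ler_piMl// ger0_norm.
have ld4 : p * (w + b * H) ^+ 2 - 4%:R * delta <=
    Qgg + 2%:R * b * Qgh + b ^+ 2 * Qhh.
  by move: ld; rewrite expr_div_n; lra.
have := ler_wpM2l b0 dev.
have := ler_wpM2l (sqr_ge0 b) Qhh1.
have : 0 <= p * (b * H) ^+ 2 by rewrite mulr_ge0 ?sqr_ge0.
rewrite mulr1; nra.
Qed.

(** Averaging the shortfall over [v], the upper bound on the odd cycle cancels the terms of order
    zero in [b]. What remains is of order b^2, so dividing by a small [b] makes the defect small. *)
Lemma odd_walk_defect p delta sigma eps b m : 0 <= p <= 1 -> 0 <= b <= 1 ->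
  weighted_dense A p delta c -> degree_defect A c p <= sigma ->
  closed_walks A mu (m + m).+2 <= p * p ^+ m.+1 ^+ 2 + eps ->
  b * walk_defect A c p m.+1 <=
  b ^+ 2 + 4%:R * delta + eps + (5%:R * m.+1%:R + 1) * sigma.
Proof.
move=> p01 b01 dense ds hC; have /andP[p0 p1] := p01; have /andP[b0 b1] := b01.
pose N := \sum_v c * \sum_x c * Num.max 0 (p ^+ m.+2 - walk A mu m.+1 v x).
have sigma0 : 0 <= sigma.
  by apply: le_trans ds; apply: sumr_ge0 => x _; rewrite mulr_ge0.
have e0 : 0 <= m.+1%:R * sigma by rewrite mulr_ge0.
have q0 : 0 <= p ^+ m.+1 by rewrite exprn_ge0.
have q1 : p ^+ m.+1 <= 1 by rewrite exprn_ile1.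
(* An absolute value is twice the negative part plus the signed value, and regularity controls the
   signed mean. *)
have defectE : walk_defect A c p m.+1 =
    2%:R * N + (\sum_x c * walks_from A mu m.+2 x - p ^+ m.+2).
  rewrite -[X in _ = _ + (_ - X)](avg_const c1) mulr_sumr -sumrB -big_split.
  apply: eq_bigr => x _; rewrite -walk_sum -[X in _ = _ + (_ - c * X)](avg_const c1).
  rewrite [LHS]mulr_sumr !mulr_sumr -sumrB -big_split; apply: eq_bigr => y _.
  rewrite -[RHS]/(2%:R * (c * (c * Num.max 0 (p ^+ m.+2 - walk A mu m.+1 x y))) +
    (c * (walk A mu m.+1 x y * c) - c * (c * p ^+ m.+2))).
  have [h|h] := lerP (p ^+ m.+2) (walk A mu m.+1 x y).
    by rewrite max_l ?subr_le0//; ring.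
  by rewrite max_r ?subr_ge0 ?ltW//; ring.
have hN : 2%:R * b * N <= 2%:R * b * (m.+1%:R * sigma) + b ^+ 2 + 4%:R * delta
    + closed_walks A mu (m + m).+2 - p * walk_moment A mu m.+1.
  apply: (@le_trans _ _ (\sum_v c * (2%:R * b * `|walks_from A mu m.+1 v - p ^+ m.+1|
     + (b ^+ 2 + 4%:R * delta)
  + \sum_x \sum_y (c * walk A mu m v x) * (c * walk A mu m v y) * A x y
  - p * walks_from A mu m.+1 v ^+ 2))).
    rewrite mulr_sumr; apply: ler_sum => v _; rewrite mulrCA ler_wpM2l//.
    by rewrite [in leRHS]addrA; exact: odd_walk_deficit.
  set Q := fun v => \sum_x \sum_y (c * walk A mu m v x) * (c * walk A mu m v y) * A x y.
  have -> : \sum_v c * (2%:R * b * `|walks_from A mu m.+1 v - p ^+ m.+1|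
      + (b ^+ 2 + 4%:R * delta) + Q v - p * walks_from A mu m.+1 v ^+ 2) =
      2%:R * b * (\sum_v c * `|walks_from A mu m.+1 v - p ^+ m.+1|)
      + (b ^+ 2 + 4%:R * delta) + \sum_v c * Q v - p * walk_moment A mu m.+1.
    rewrite -[X in _ = _ + X + _ - _](avg_const c1) /walk_moment.
    rewrite [2%:R * b * _]mulr_sumr [p * _]mulr_sumr -!big_split -sumrB.
    by apply: eq_bigr => v _; move: (walks_from A mu m.+1 v) => w; rewrite /=; ring.
  rewrite -odd_closed_walks//.
  have := walks_from_near A01 c0 c1 m.+1 p01 ds.
  have : 0 <= 2%:R * b by rewrite mulr_ge0.
  move=> b2 /(ler_wpM2l b2); lra.
(* The square is bounded below by its tangent at p^(m+1). *)
have moment_ge : p ^+ m.+1 ^+ 2 - 2%:R * (m.+1%:R * sigma) <= walk_moment A mu m.+1.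
  have := walks_near_sum m.+1 p01 ds; rewrite ler_norml => /andP[h _].
  have : \sum_x c * (2%:R * p ^+ m.+1 * walks_from A mu m.+1 x - p ^+ m.+1 ^+ 2)
      <= walk_moment A mu m.+1.
    by apply: ler_sum => x _; rewrite ler_wpM2l//; have := sqr_ge0 (walks_from A mu m.+1 x - p ^+ m.+1); lra.
  under eq_bigr do rewrite mulrBr mulrCA.
  rewrite sumrB -mulr_sumr avg_const//; nra.
have := walks_near_sum m.+2 p01 ds; rewrite ler_norml => /andP[_ h].
rewrite defectE; have := ler_wpM2l b0 h; have := ler_wpM2l p0 moment_ge.
have : b * (m.+1%:R * sigma) <= m.+1%:R * sigma by rewrite ler_piMl.
have : p * (m.+1%:R * sigma) <= m.+1%:R * sigma by rewrite ler_piMl.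
have : b * sigma <= sigma by rewrite ler_piMl.
rewrite [m.+2%:R]mulrSr; move: hN hC.
move: (m.+1%:R) (closed_walks _ _ _) (walk_moment _ _ _) (p ^+ m.+1 ^+ 2) => M C a q.
lra.
Qed.

End DenseUniform.

(** * Forcing for cycles *)

Section Forcing.
Variable R : realFieldType.
Implicit Types (p kappa tau theta delta c : R) (T : finType).

Definition normalized_kernel T (A : T -> T -> R) c : Prop :=
  [/\ forall x y, 0 <= A x y <= 1, forall x y, A x y = A y x, 0 <= c
    & \sum_(x : T) c = 1].

Definition cut_near T (A : T -> T -> R) c p kappa : Prop := forall S : {set T},
  `|\sum_(x in S) \sum_(y in S) c * c * A x y - p * (\sum_(x in S) c) ^+ 2|
    <= kappa.

Lemma weighted_dense_le T (A : T -> T -> R) p delta delta' c :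
  delta <= delta' -> weighted_dense A p delta c -> weighted_dense A p delta' c.
Proof. by move=> dd dense g gc; apply: le_trans (dense g gc); rewrite lerD2l lerN2. Qed.

Lemma cut_near_of_walk_defect p kappa M : 0 <= p <= 1 -> 0 < kappa ->
  exists2 tau, 0 < tau <= 1 & forall T (A : T -> T -> R) c,
    normalized_kernel A c -> degree_defect A c p <= tau ->
    walk_defect A c p M <= tau -> cut_near A c p kappa.
Proof.
move=> p01 k0; set K : R := (2 ^ M)%:R.
have K0 : 0 < 1 + K by rewrite ltr_pwDl.
have h0 : 0 < (kappa / 2%:R) ^+ (2 ^ M) by rewrite exprn_gt0// divr_gt0.
pose t := (kappa / 2%:R) ^+ (2 ^ M) / (1 + K).
have t0 : 0 < t by rewrite divr_gt0.
(* In [cut_close], [kappa / 6] pays for 3 sigma and [t] for the power of [kappa / 2]. *)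
exists (Num.min (Num.min 1 (kappa / 6%:R)) t).
  by rewrite !lt_min ltr01 t0 divr_gt0//= !ge_min lexx.
move=> T A c [A01 Asym c0 c1]; set tau := Num.min _ t => dd dw S.
have tau6 : tau <= kappa / 6%:R by rewrite /tau !ge_min lexx orbT.
have taut : tau <= t by rewrite /tau !ge_min lexx orbT.
have tE : t * (1 + K) = (kappa / 2%:R) ^+ (2 ^ M) by rewrite mulfVK// gt_eqF.
have k2 : 0 <= kappa / 2%:R by rewrite divr_ge0// ltW.
apply: le_trans (cut_close A01 Asym c0 c1 S p01 dd dw k2 _) _; last lra.
by rewrite -tE -[X in X + _]mul1r -mulrDl mulrC ler_wpM2r// ltW.
Qed.

(** The walk index [M] is chosen before [tau] because the tolerance of [cut_near_of_walk_defect]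
    depends on [M]. *)
Lemma walk_defect_of_closed_walks p k : 0 < p < 1 -> exists M, forall tau,
  0 < tau -> exists2 theta, 0 < theta <= 1 & forall T (A : T -> T -> R) c,
    normalized_kernel A c -> weighted_dense A p theta c ->
    degree_defect A c p <= theta ->
    closed_walks A (fun=> c) k.+2 <= p ^+ k.+3 + theta ->
    walk_defect A c p M <= tau.
Proof.
move=> /andP[p0 p1]; have p01 : 0 <= p <= 1 by rewrite !ltW.
have [m [km|km]] := half_cases k; exists m.+1 => tau t0.
- have N0 : 0 < 5%:R * m.+1%:R + 7%:R :> R by rewrite ltr_wpDl// mulr_ge0.
  set N : R := _ + _ in N0.
  (* With [theta] equal to b^2, the coefficients 1, 4, 1 and 5(m+1)+1 in [odd_walk_defect] add up to
     [N], so the defect is at most N b. *)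
  pose b := Num.min 1 (tau / N).
  have b0 : 0 < b by rewrite lt_min ltr01 divr_gt0.
  have b1 : b <= 1 by rewrite ge_min lexx.
  exists (b ^+ 2); first by rewrite exprn_gt0// exprn_ile1// ltW.
  move=> T A c [A01 Asym c0 c1] dense dd.
  have -> : p ^+ k.+3 = p * p ^+ m.+1 ^+ 2.
    by rewrite -exprM -exprS km muln2 -addnn addnS addSn.
  rewrite km => hC; rewrite -(ler_pM2l b0).
  apply: le_trans (odd_walk_defect A01 Asym c0 c1 p01 _ dense dd hC) _.
    by rewrite b1 ltW.
  have -> : b ^+ 2 + 4%:R * b ^+ 2 + b ^+ 2 + (5%:R * m.+1%:R + 1) * b ^+ 2 =
    b * (N * b) by rewrite /N; ring.
  rewrite ler_wpM2l ?(ltW b0)// mulrC -ler_pdivlMr// /b ge_min.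
  by rewrite lexx orbT.
- have N0 : 0 < 1 + 2%:R * m.+2%:R :> R by rewrite ltr_pwDl// mulr_ge0.
  set N : R := _ + _ in N0.
  exists (Num.min 1 (tau ^+ 2 / N)).
    by rewrite lt_min ltr01 divr_gt0 ?exprn_gt0//= ge_min lexx.
  move=> T A c [A01 Asym c0 c1] dense dd.
  have -> : p ^+ k.+3 = p ^+ m.+2 ^+ 2.
    by rewrite -exprM km muln2 -addnn !addnS !addSn.
  have -> : k.+2 = (m.+1 + m.+1).+1 by rewrite km addnS addSn.
  move=> hC; rewrite -(@ler_pXn2r _ 2) ?nnegrE ?(ltW t0)//; last first.
    apply: sumr_ge0 => x _; rewrite mulr_ge0//; apply: sumr_ge0 => y _.
    by rewrite mulr_ge0.
  apply: le_trans (even_walk_defect A01 Asym c0 c1 p01 dd hC) _.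
  set t := Num.min _ _; have : t <= tau ^+ 2 / N by rewrite ge_min lexx orbT.
  rewrite ler_pdivlMr// mulrDr mulr1 /N; lra.
Qed.

Lemma closed_walks_forcing p kappa k : 0 < p < 1 -> 0 < kappa ->
  exists2 eps, 0 < eps <= 1 & forall T (A : T -> T -> R) c,
    normalized_kernel A c -> weighted_dense A p eps c ->
    p ^+ k.+3 + eps < closed_walks A (fun=> c) k.+2 \/ cut_near A c p kappa.
Proof.
move=> p01' k0; have /andP[p0 p1] := p01'; have p01 : 0 <= p <= 1 by rewrite !ltW.
have [M hM] := walk_defect_of_closed_walks k p01'.
have [tau /andP[tau0 tau1] hcut] := cut_near_of_walk_defect M p01 k0.
have [theta /andP[th0 th1] hwalk] := hM tau tau0.
(* [sigma] is the regularity threshold: below it [hwalk] and [hcut] both apply, above it the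
   irregular gain [g] does. *)
pose sigma := Num.min tau theta.
have s0 : 0 < sigma by rewrite lt_min tau0.
have stau : sigma <= tau by rewrite ge_min lexx.
have sth : sigma <= theta by rewrite ge_min lexx orbT.
have s1 : sigma <= 1 by exact: le_trans tau1.
set g := p ^+ k.+3 * sigma ^+ 2 / 8%:R.
have g0 : 0 < g by rewrite divr_gt0// mulr_gt0// exprn_gt0.
exists (Num.min theta g).
  by rewrite lt_min th0 g0 ge_min th1.
move=> T A c K dense; have [A01 Asym c0 c1] := K.
have eg : Num.min theta g <= g by rewrite ge_min lexx orbT.
have eth : Num.min theta g <= theta by rewrite ge_min lexx.
have [irr|reg] := lerP (sigma ^+ 2) (degree_variance A c p).
  left; apply: le_lt_trans (closed_walks_irregular A01 Asym c0 c1 p01' (ltW g0) _ _ _ irr).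
  - by rewrite lerD2l.
  - by rewrite s0 s1.
  - exact: weighted_dense_le dense.
  - exact: lexx.
have dd : degree_defect A c p <= sigma.
  by apply: (degree_defect_le c0 c1); rewrite ltW.
have [|hC] := ltrP (p ^+ k.+3 + Num.min theta g) (closed_walks A (fun=> c) k.+2).
  by left.
right; apply: hcut => //; first exact: le_trans stau.
apply: hwalk => //; first exact: weighted_dense_le dense.
  exact: le_trans sth.
by apply: le_trans hC _; rewrite lerD2l.
Qed.

End Forcing.

(** * Graphs as kernels *)

Lemma set2_eq (T : finType) (x y u v : T) : x != y ->
  ([set u; v] == [set x; y]) = ((u, v) \in [set (x, y); (y, x)]).
Proof.
move=> xy; rewrite !inE !xpair_eqE; apply/eqP/idP; last first.
  by case/orP => /andP[/eqP -> /eqP ->] //; rewrite setUC.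
move=> e.
have : [&& u \in [set x; y], v \in [set x; y], x \in [set u; v] & y \in [set u; v]].
  by rewrite -{1 2}e {3 4}e !inE !eqxx !orbT.
rewrite !inE => /and4P[/orP[]/eqP-> /orP[]/eqP->]; rewrite ?eqxx ?orbT ?orbb //.
  by move=> _; rewrite eq_sym (negbTE xy).
by rewrite (negbTE xy).
Qed.

(** Edges are two-element sets, and the fibre of an edge under (x, y) |-> {x, y} has exactly two
    ordered pairs, by irreflexivity. *)
Lemma e_in_double (G : sgraph) (S : {set vtx G}) :
  (e_in S * 2 = \sum_(x in S) \sum_(y in S) adj G x y)%N.
Proof.
rewrite pair_big /= (eq_bigr (fun q => if adj G q.1 q.2 then 1 else 0)%N); last first.
  by move=> [x y] _ /=; case: (adj _ _ _).
rewrite -big_mkcondr /=.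
rewrite (partition_big (fun q => [set q.1; q.2])
   [in [set E : {set vtx G} | is_edge E && (E \subset S)]]) /=.
  rewrite /e_in -sum_nat_const; apply: eq_bigr => E.
  rewrite inE => /andP[/existsP[x /existsP[y /andP[xy /eqP ->]]]].
  rewrite subUset !sub1set => /andP[xS yS].
  have nxy : x != y by apply: contraTneq xy => ->; rewrite adj_irr.
  rewrite sum1dep_card (_ : [set _ | _] = [set (x, y); (y, x)]).
    by rewrite cards2 xpair_eqE (negbTE nxy).
  apply/setP => -[u v]; rewrite inE /= set2_eq//.
  rewrite andb_idl// !inE !xpair_eqE => /orP[] /andP[/eqP-> /eqP->] /=.
    by rewrite xS yS xy.
  by rewrite xS yS adj_sym xy.
move=> [x y] /= /andP[/andP[xS yS] xy].
rewrite inE subUset !sub1set xS yS !andbT.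
by apply/existsP; exists x; apply/existsP; exists y; rewrite xy eqxx.
Qed.

Lemma nedges_double (G : sgraph) :
  (nedges G * 2 = \sum_x \sum_y adj G x y)%N.
Proof.
rewrite e_in_double; apply: eq_big => [x|x _]; first by rewrite inE.
by apply: eq_bigl => y; rewrite inE.
Qed.

Section Kernel.
Variable R : realType.
Implicit Types (G H : sgraph) (p delta alpha kappa : R).

Definition adjk G (x y : vtx G) : R := (adj G x y)%:R.

Definition vwt G : R := (#|vtx G|)%:R^-1.

Lemma e_in_double_adjk G (S : {set vtx G}) :
  (e_in S)%:R * 2%:R = \sum_(x in S) \sum_(y in S) adjk x y.
Proof.
rewrite -natrM e_in_double natr_sum; apply: eq_bigr => x _.
by rewrite natr_sum.
Qed.

Lemma adjk01 G (x y : vtx G) : 0 <= adjk x y <= 1.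
Proof. by rewrite /adjk ler0n lern1 leq_b1. Qed.

Lemma adjkC G (x y : vtx G) : adjk x y = adjk y x.
Proof. by rewrite /adjk adj_sym. Qed.

Lemma vwt_ge0 G : 0 <= vwt G.
Proof. by rewrite invr_ge0. Qed.

Lemma vwtK G : (0 < #|vtx G|)%N -> vwt G * (#|vtx G|)%:R = 1.
Proof. by move=> n0; rewrite mulVf// pnatr_eq0 -lt0n. Qed.

Lemma adjk_normalized G : (0 < #|vtx G|)%N -> normalized_kernel (@adjk G) (vwt G).
Proof.
move=> n0; split; [exact: adjk01|exact: adjkC|exact: vwt_ge0|].
by rewrite sumr_const -[_ *+ _]mulr_natr vwtK.
Qed.

(* The form is concave in each coordinate of [f] because the diagonal of [A]
   vanishes, so its minimum over the cube is attained at an indicator function. *)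
Lemma dense_form_cube (T : finType) (A : T -> T -> R) (p e : R) :
  0 <= p -> (forall x, A x x = 0) -> (forall x y, A x y = A y x) ->
  (forall S : {set T},
     p * (#|S|)%:R ^+ 2 - e <= \sum_(x in S) \sum_(y in S) A x y) ->
  forall f : T -> R, (forall x, 0 <= f x <= 1) ->
  p * (\sum_x f x) ^+ 2 - e <= \sum_x \sum_y f x * f y * A x y.
Proof.
move=> p0 Aii Asym dense.
suff main (s : seq T) (f : T -> R) : (forall x, 0 <= f x <= 1) ->
    (forall x, x \notin s -> f x = 0 \/ f x = 1) ->
    p * (\sum_x f x) ^+ 2 - e <= \sum_x \sum_y f x * f y * A x y.
  by move=> f f01; apply: (main (enum T)) => // x; rewrite mem_enum.
elim: s f => [|x0 s IHs] f f01 fs.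
  pose S := [set x | f x == 1].
  have fE x : f x = (x \in S)%:R.
    rewrite inE; case: eqP => [->//|f1].
    by have [||] := fs x; rewrite ?in_nil.
  have := dense S; congr (_ * _ ^+ 2 - _ <= _).
    rewrite -sum1_card natr_sum big_mkcond.
    by apply: eq_bigr => x _; rewrite fE; case: (x \in S).
  rewrite big_mkcond; apply: eq_bigr => x _; rewrite fE.
  case: (x \in S); last by rewrite big1// => y _; rewrite !mul0r.
  rewrite big_mkcond; apply: eq_bigr => y _; rewrite fE mul1r.
  by case: (y \in S); rewrite ?mul1r ?mul0r.
pose upd (t : R) x := if x == x0 then t else f x.
pose r := \sum_(x | x != x0) f x.
pose L := \sum_(x | x != x0) f x * A x0 x.
pose Q := \sum_(x | x != x0) \sum_(y | y != x0) f x * f y * A x y.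
have sum_upd t : \sum_x upd t x = t + r.
  rewrite (bigD1 x0)//= /upd eqxx; congr (_ + _).
  by apply: eq_bigr => x /negbTE->.
have form_upd t : \sum_x \sum_y upd t x * upd t y * A x y = 2%:R * t * L + Q.
  rewrite (bigD1 x0)//= (bigD1 x0)//= Aii mulr0 add0r.
  have -> : \sum_(x | x != x0) upd t x0 * upd t x * A x0 x = t * L.
    rewrite mulr_sumr; apply: eq_bigr => x /negbTE h.
    by rewrite /upd eqxx h mulrA.
  have -> : \sum_(x | x != x0) \sum_y upd t x * upd t y * A x y = t * L + Q.
    rewrite mulr_sumr -big_split; apply: eq_bigr => x /negbTE h.
    rewrite (bigD1 x0)//= /upd eqxx h [A x0 x]Asym; congr (_ + _); first by ring.
    by apply: eq_bigr => y /negbTE->.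
  ring.
have ends t : t = 0 \/ t = 1 -> p * (t + r) ^+ 2 - e <= 2%:R * t * L + Q.
  move=> t01; rewrite -sum_upd -form_upd; apply: IHs.
    by move=> x; rewrite /upd; case: eqP => // _; case: t01 => ->; rewrite ?lexx ?ler01.
  move=> x xs; rewrite /upd; case: eqP => // /eqP xx0; apply: fs.
  by rewrite in_cons negb_or xx0.
have fupd x : f x = upd (f x0) x by rewrite /upd; case: eqP => [->|].
rewrite (eq_bigr _ (fun x _ => fupd x)) sum_upd.
rewrite (eq_bigr (fun x => \sum_y upd (f x0) x * upd (f x0) y * A x y)); last first.
  by move=> x _; apply: eq_bigr => y _; rewrite -!fupd.
rewrite form_upd; have /andP[t0 t1] := f01 x0.
have := ends 0 (or_introl erefl); have := ends 1 (or_intror erefl).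
move: (f x0) t0 t1 => t t0 t1; rewrite mulr0 mul0r !add0r => e1 e0.
have t1' : 0 <= 1 - t by rewrite subr_ge0.
have := ler_wpM2l t0 e1; have := ler_wpM2l t1' e0.
have := mulr_ge0 p0 (mulr_ge0 t0 t1'); nra.
Qed.

Lemma locally_dense_weighted G p delta : (0 < #|vtx G|)%N -> 0 < p < 1 ->
  0 < delta <= 1 -> locally_dense p delta G ->
  weighted_dense (@adjk G) p delta (vwt G).
Proof.
move=> n0 /andP[p0 p1] /andP[d0 d1] dense g gc.
set n : R := (#|vtx G|)%:R; have cn : vwt G * n = 1 by exact: vwtK.
have npos : 0 < n by rewrite ltr0n.
have := @dense_form_cube (vtx G) (@adjk G) p (delta * n ^+ 2) (ltW p0) _
  (@adjkC G) _ (fun x => n * g x).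
have gE : \sum_x n * g x = n * \sum_x g x by rewrite mulr_sumr.
have formE : \sum_x \sum_y n * g x * (n * g y) * adjk x y =
    n ^+ 2 * \sum_x \sum_y g x * g y * adjk x y.
  rewrite mulr_sumr; apply: eq_bigr => x _; rewrite mulr_sumr.
  by apply: eq_bigr => y _; ring.
have -> : p * (\sum_x n * g x) ^+ 2 - delta * n ^+ 2 =
    n ^+ 2 * (p * (\sum_x g x) ^+ 2 - delta) by rewrite gE; ring.
rewrite formE ler_pM2l ?exprn_gt0//; apply.
- by move=> x; rewrite /adjk adj_irr.
(* A set below the size threshold satisfies p |S|^2 <= (delta n)^2 <= delta n^2, so the error term
   covers it. *)
- move=> S; have [big|small] := lerP (delta * n) (#|S|)%:R.
    have := dense S big; rewrite ler_pdivrMr// e_in_double_adjk.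
    by apply: le_trans; rewrite gerBl mulr_ge0 ?ltW// exprn_gt0.
  apply: le_trans (_ : 0 <= _); last first.
    by apply: sumr_ge0 => x _; apply: sumr_ge0 => y _; have /andP[] := adjk01 x y.
  rewrite subr_le0; apply: (@le_trans _ _ (#|S|%:R ^+ 2)).
    by rewrite ler_piMl ?exprn_ge0 ?(ltW p1).
  apply: (@le_trans _ _ ((delta * n) ^+ 2)).
    by rewrite lerXn2r ?nnegrE ?mulr_ge0 ?(ltW d0) ?(ltW npos) ?(ltW small).
  by rewrite exprMn ler_wpM2r ?exprn_ge0 ?(ltW npos)// expr2 ler_piMl// ltW.
- move=> x; have /andP[g0 gx] := gc x.
  by rewrite mulr_ge0 ?(ltW npos)//= -cn mulrC ler_wpM2r// ltW.
Qed.

(** The kernel form counts each edge twice, hence the factor 2 before [alpha]. *)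
Lemma quasirandom_of_cut_near G p alpha kappa : (0 < #|vtx G|)%N ->
  kappa <= 2%:R * alpha -> cut_near (@adjk G) (vwt G) p kappa ->
  quasirandom p alpha G.
Proof.
move=> n0 ka near S; have := near S.
set n : R := (#|vtx G|)%:R; have cn : vwt G * n = 1 by exact: vwtK.
have npos : 0 < n by rewrite ltr0n.
have -> : \sum_(x in S) vwt G = vwt G * (#|S|)%:R by rewrite sumr_const mulr_natr.
have -> : \sum_(x in S) \sum_(y in S) vwt G * vwt G * adjk x y =
    vwt G ^+ 2 * ((e_in S)%:R * 2%:R).
  rewrite e_in_double_adjk mulr_sumr; apply: eq_bigr => x _.
  by rewrite mulr_sumr.
have -> : vwt G ^+ 2 * ((e_in S)%:R * 2%:R) - p * (vwt G * (#|S|)%:R) ^+ 2 =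
  (2%:R * vwt G ^+ 2) * ((e_in S)%:R - p / 2 * (#|S|)%:R ^+ 2) by field.
rewrite normrM ger0_norm ?mulr_ge0 ?exprn_ge0 ?vwt_ge0// => /le_trans/(_ ka).
move: `|_| => X h.
have {}h : vwt G ^+ 2 * X <= alpha by lra.
have -> : X = vwt G ^+ 2 * X * n ^+ 2 by rewrite mulrAC -exprMn cn expr1n mul1r.
by rewrite ler_wpM2r ?exprn_ge0 ?(ltW npos).
Qed.

End Kernel.

(** * Homomorphism densities of cycles and wheels *)

Lemma natr_forall (R : comPzSemiRingType) (T : finType) (b : pred T) :
  ([forall x, b x])%:R = \prod_x (b x)%:R :> R.
Proof.
have [/forallP h|] := boolP [forall x, b x].
  by rewrite big1// => x _; rewrite h.
rewrite negb_forall => /existsP[x /negbTE bx].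
by rewrite (bigD1 x)//= bx mul0r.
Qed.

Lemma natr_andb (R : pzSemiRingType) (a b : bool) : (a && b)%:R = a%:R * b%:R :> R.
Proof. by rewrite -natrM mulnb. Qed.

(** [e'] views [J] as [option I]; this serves both the first coordinate of an ordinal and the hub of
    a wheel. *)
Definition ffun_cons (I J T : finType) (e' : J -> option I) (x : T)
  (g : {ffun I -> T}) : {ffun J -> T} :=
  [ffun j => if e' j is Some i then g i else x].

Lemma big_ffun_cons (R : nmodType) (I J T : finType) (e : option I -> J)
    (e' : J -> option I) (F : {ffun J -> T} -> R) :
  cancel e e' -> cancel e' e ->
  \sum_f F f = \sum_x \sum_g F (ffun_cons e' x g).
Proof.
move=> eK e'K; rewrite pair_bigA.
rewrite (reindex (fun q : T * {ffun I -> T} => ffun_cons e' q.1 q.2)) //=.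
exists (fun f : {ffun J -> T} => (f (e None), [ffun i => f (e (Some i))])).
  move=> [x g] _ /=; rewrite ffunE eK; congr (_, _).
  by apply/ffunP => i; rewrite !ffunE eK.
move=> f _; apply/ffunP => j; rewrite ffunE.
by case E : (e' j) => [i|]; rewrite ?ffunE -E e'K.
Qed.

Lemma big_option (I : finType) (F : option I -> nat) :
  (\sum_u F u = F None + \sum_i F (Some i))%N.
Proof.
rewrite (bigD1 None)//=; congr (_ + _).
rewrite (reindex_omap Some id) /=; last by case.
by apply: eq_bigl => i; rewrite eqxx.
Qed.

Definition ord_cons k (u : option 'I_k) : 'I_k.+1 := oapp (lift ord0) ord0 u.

Lemma ord_consK k : cancel (@ord_cons k) (unlift ord0).
Proof. by case=> [i|]; rewrite /ord_cons ?liftK ?unlift_none. Qed.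

Lemma unliftK0 k : cancel (unlift ord0) (@ord_cons k).
Proof. by move=> j; case: unliftP => [i ->|->]. Qed.

Definition is_hom H G (f : vtx H -> vtx G) : bool :=
  [forall x, forall y, adj H x y ==> adj G (f x) (f y)].

Section HomDens.
Variable R : realType.

Lemma hom_densE H G : hom_dens R H G =
  \sum_(f : {ffun vtx H -> vtx G}) vwt R G ^+ #|vtx H| * (is_hom f)%:R.
Proof.
rewrite /hom_dens card_ffun natrX -exprVn mulrC -mulr_sumr; congr (_ * _).
rewrite -sum1_card natr_sum big_mkcond; apply: eq_bigr => f _.
by rewrite inE /is_hom; case: ifP.
Qed.

Section Walks.
Variables (T : finType) (A : T -> T -> R).

(** Continues the interior vertices of a walk by its endpoint [y]: out-of-range indices return
    [y]. *)
Definition pad k (y : T) (g : {ffun 'I_k -> T}) (n : nat) : T :=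
  if insub n is Some i then g i else y.

Lemma pad_cons0 k y x (g : {ffun 'I_k -> T}) :
  pad y (ffun_cons (unlift ord0) x g) 0 = x.
Proof. by rewrite /pad insubT ffunE (_ : Sub _ _ = ord0) ?unlift_none//; apply: val_inj. Qed.

Lemma pad_consS k y x (g : {ffun 'I_k -> T}) n :
  pad y (ffun_cons (unlift ord0) x g) n.+1 = pad y g n.
Proof.
rewrite /pad; case: (ltnP n k) => nk; last first.
  by rewrite !insubF// ?ltnS ltnNge nk.
rewrite !insubT ffunE (_ : Sub _ _ = lift ord0 (Ordinal nk)) ?liftK; last exact: val_inj.
by congr (g _); apply: val_inj.
Qed.

Lemma ffun_cons0 k x (g : {ffun 'I_k -> T}) : ffun_cons (unlift ord0) x g ord0 = x.
Proof. by rewrite ffunE unlift_none. Qed.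

Lemma ffun_consS k x (g : {ffun 'I_k -> T}) i :
  ffun_cons (unlift ord0) x g (lift ord0 i) = g i.
Proof. by rewrite ffunE liftK. Qed.

Lemma walk_sum_ffun mu k x y :
  \sum_(g : {ffun 'I_k -> T}) A x (pad y g 0) *
     \prod_i (mu (g i) * A (g i) (pad y g i.+1)) = walk A mu k x y.
Proof.
elim: k x => [|k IHk] x /=.
  rewrite (eq_bigr (fun=> A x y)) => [|g _].
    by rewrite sumr_const card_ffun card_ord expn0.
  by rewrite big_ord0 mulr1 /pad insubF.
rewrite (big_ffun_cons _ (@ord_consK k) (@unliftK0 k)); apply: eq_bigr => z _.
rewrite -IHk mulr_sumr; apply: eq_bigr => g _.
rewrite pad_cons0 big_ord_recl ffun_cons0 pad_consS !mulrA; congr (_ * _).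
by apply: eq_bigr => i _; rewrite ffun_consS pad_consS.
Qed.

Lemma ordS_val k (i : 'I_k.+1) : ordS i = (if i == k :> nat then 0 else i.+1)%N :> nat.
Proof.
rewrite /=; case: eqP => [->|h]; first by rewrite modnn.
by rewrite modn_small//; have := ltn_ord i; lia.
Qed.

Lemma closed_walks_sum_ffun mu k :
  \sum_(f : {ffun 'I_k.+1 -> T}) \prod_i (mu (f i) * A (f i) (f (ordS i))) =
  closed_walks A mu k.
Proof.
rewrite (big_ffun_cons _ (@ord_consK k) (@unliftK0 k)); apply: eq_bigr => x _.
rewrite -walk_sum_ffun mulr_sumr; apply: eq_bigr => g _.
set f := ffun_cons _ _ _.
(* The cyclic successor wraps to index 0, where the value is [x], the endpoint used for padding. *)
have fE n (j : 'I_k.+1) : nat_of_ord j = (if n == k then 0 else n.+1)%N -> f j = pad x g n.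
  move=> jn; rewrite -(pad_consS x x g) -/f /pad.
  case: (ltnP n k) => nk; last first.
    rewrite insubF ?ltnS ?ltnNge ?nk//.
    have -> : j = ord0.
      apply: val_inj; rewrite /= jn; have := ltn_ord j; rewrite jn.
      by case: eqP => //; lia.
    exact: ffun_cons0.
  rewrite insubT; congr (f _); apply: val_inj; rewrite /= jn.
  by case: eqP => //; lia.
rewrite big_ord_recl /f ffun_cons0 -/f (fE 0%N (ordS ord0) (ordS_val ord0)) !mulrA.
congr (_ * _); apply: eq_bigr => i _; rewrite /f ffun_consS -/f.
by rewrite (fE i.+1) ?ordS_val.
Qed.

End Walks.

(** With at least two vertices no index is its own successor, so the disequality in [cyc_adj] is
    automatic. *)
Lemma cyc_adjE k (i j : 'I_k.+2) :
  cyc_adj i j = (j == ordS i) || (i == ordS j).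
Proof.
rewrite /cyc_adj -!val_eqE /= andb_idl// => /orP[] /eqP h; apply/eqP => ij;
  move: h; rewrite ij.
  have := ordS_val j; rewrite /= => ->; case: eqP => [->|]; lia.
have := ordS_val j; rewrite /= => ->; case: eqP => [->|]; lia.
Qed.

Lemma is_hom_cycle k G (f : 'I_k.+2 -> vtx G) :
  is_hom (H := cycle_graph k.+2) f = [forall i, adj G (f i) (f (ordS i))].
Proof.
apply/forallP/forallP => h i.
  by have /forallP/(_ (ordS i)) := h i; rewrite /= cyc_adjE eqxx.
apply/forallP => j; apply/implyP; rewrite /= cyc_adjE => /orP[] /eqP ->//.
by rewrite adj_sym.
Qed.

Lemma hom_dens_cycle k G :
  hom_dens R (cycle_graph k.+2) G = closed_walks (@adjk R G) (fun=> vwt R G) k.+1.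
Proof.
rewrite hom_densE -closed_walks_sum_ffun card_ord; apply: eq_bigr => f _.
rewrite is_hom_cycle natr_forall big_split /= prodr_const card_ord //.
Qed.

Lemma hom_dens_wheel k G : hom_dens R (wheel_graph k.+2) G =
  \sum_v vwt R G * closed_walks (@adjk R G) (fun x => vwt R G * adjk R v x) k.+1.
Proof.
rewrite hom_densE card_option card_ord.
rewrite (@big_ffun_cons _ _ _ _ id id)//; apply: eq_bigr => v _.
rewrite -closed_walks_sum_ffun mulr_sumr; apply: eq_bigr => g _.
have -> : is_hom (ffun_cons id v g : {ffun vtx (wheel_graph k.+2) -> vtx G}) =
    [forall i, adj G v (g i)] && is_hom (H := cycle_graph k.+2) g.
  apply/forallP/andP => [h|[/forallP h1 /forallP h2] [i|]]; first split.
  - by apply/forallP => i; have /forallP/(_ (Some i)) := h None; rewrite /= !ffunE.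
  - apply/forallP => i; apply/forallP => j.
    by have /forallP/(_ (Some j)) := h (Some i); rewrite /= !ffunE.
  - apply/forallP => -[j|]; rewrite /= !ffunE; last by rewrite adj_sym h1.
    by have /forallP := h2 i; apply.
  - by apply/forallP => -[j|] //=; rewrite !ffunE h1.
rewrite natr_andb is_hom_cycle !natr_forall !big_split /= prodr_const card_ord.
by rewrite [vwt R G ^+ k.+3]exprS !mulrA.
Qed.

Lemma nedges_cycle k : nedges (cycle_graph k.+3) = k.+3.
Proof.
apply/eqP; rewrite -(eqn_pmul2r (isT : 0 < 2)%N) nedges_double /=; apply/eqP.
transitivity (\sum_(i < k.+3) \sum_(j < k.+3) ((j == ordS i) + (i == ordS j)))%N.
  apply: eq_bigr => i _; apply: eq_bigr => j _; rewrite cyc_adjE.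
  (* With at least three vertices, two indices cannot be successors of each other, so the
     disjunction becomes a sum. *)
  case: eqP => [->|] //=; case: eqP => // /(congr1 (@nat_of_ord _)).
  rewrite ordS_val ordS_val; have := ltn_ord i.
  by do 2!case: eqP; lia.
under eq_bigr do rewrite big_split /=.
rewrite big_split /= [X in (_ + X)%N]exchange_big /=.
have e (i : 'I_k.+3) : (\sum_(j < k.+3) (j == ordS i) = 1)%N.
  by rewrite (bigD1 (ordS i))//= eqxx big1// => j /negbTE ->.
by under eq_bigr do rewrite e; rewrite sum1_card card_ord addnn muln2.
Qed.

Lemma nedges_wheel k : nedges (wheel_graph k.+3) = (k.+3 + k.+3)%N.
Proof.
apply/eqP; rewrite -(eqn_pmul2r (isT : 0 < 2)%N) nedges_double /=; apply/eqP.
rewrite big_option big_option /= add0n.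
under [X in (_ + X)%N]eq_bigr do rewrite big_option /=.
rewrite big_split /= sum1_card card_ord.
have := nedges_double (cycle_graph k.+3); rewrite nedges_cycle /= => <-.
by rewrite !muln2 -!addnn addnA.
Qed.

Lemma nedges_clique k : nedges (clique_graph k) = 'C(k, 2).
Proof.
apply/eqP; rewrite -(eqn_pmul2r (isT : 0 < 2)%N) nedges_double /=; apply/eqP.
transitivity (\sum_(i < k) k.-1)%N.
  apply: eq_bigr => i _; rewrite -[in RHS](card_ord k) -(cardC1 i) -sum1_card.
  rewrite [RHS]big_mkcond; apply: eq_bigr => j _.
  by rewrite !inE eq_sym; case: eqP.
by rewrite sum_nat_const card_ord bin2 muln2 -[LHS]odd_double_half; case: k => //= k; rewrite oddM /= andNb.
Qed.

End HomDens.

(** * Forcing for wheels *)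

Section WheelSum.
Variable R : realFieldType.
Implicit Types (p kappa sigma s c : R) (T : finType).

Definition cone_walks T (A : T -> T -> R) c k :=
  \sum_v c * closed_walks A (fun x => c * A v x) k.

(** In the irregular case the triangle density at [v] is replaced by p phi(v)^2, and convexity of
    the power k+3 yields the variance. In the near-regular case phi(v) is replaced by [p], leaving
    the global triangle density. *)
Lemma cone_walks_ge T (A : T -> T -> R) c p s sigma k :
  normalized_kernel A c -> 0 < p < 1 -> 0 < s <= 1 -> 0 <= sigma ->
  weighted_dense A p (s ^+ 2) c ->
  (sigma ^+ 2 <= degree_variance A c p ->
    p ^+ (k.+3 + k.+3) + p ^+ (k.+2 + k.+2) * sigma ^+ 2
      - (k.*2 + 7)%:R * s <= cone_walks A c k.+2) /\
  (degree_defect A c p <= sigma ->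
    p ^+ (k.*2 + 3) * closed_walks A (fun=> c) 2 - k.+1%:R * sigma - k.+3%:R * s
      <= cone_walks A c k.+2).
Proof.
move=> [A01 Asym c0 c1] p01' /andP[s0 s1] sig0 dense.
have /andP[p0 p1] := p01'; have p01 : 0 <= p <= 1 by rewrite !ltW.
have ppow j : 0 <= p ^+ j by rewrite exprn_ge0 ?(ltW p0).
have ppow1 j : p ^+ j <= 1 by rewrite exprn_ile1 ?(ltW p0) ?(ltW p1).
have A0 x y : 0 <= A x y by have /andP[] := A01 x y.
have A1 x y : A x y <= 1 by have /andP[] := A01 x y.
(* The uniform weight on the neighbourhood of [v]; its mass [phi v] is the degree and its form [t v]
   the triangle density at [v]. *)
pose mu v x := c * A v x.
have mu0c v x : 0 <= mu v x <= c by rewrite mulr_ge0//= ler_piMr.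
pose phi v := \sum_x mu v x.
have phiE v : phi v = walks_from A (fun=> c) 1 v.
  by apply: eq_bigr => x _ /=; rewrite mulr1 mulrC.
have phi01 v : 0 <= phi v <= 1.
  by rewrite phiE; apply: walks_from_bound => //; rewrite c1.
pose t v := \sum_x \sum_y mu v x * mu v y * A x y.
have t0 v : 0 <= t v.
  by apply: sumr_ge0 => x _; apply: sumr_ge0 => y _; rewrite !mulr_ge0.
have t1 v : t v <= 1.
  apply: (@le_trans _ _ (\sum_x mu v x * phi v)).
    apply: ler_sum => x _; rewrite mulr_sumr; apply: ler_sum => y _.
    by rewrite ler_piMr// !mulr_ge0.
  by rewrite -mulr_suml -/(phi v); have /andP[a b] := phi01 v; rewrite -[leRHS]mulr1 ler_pM.
have tri : \sum_v c * t v = closed_walks A (fun=> c) 2.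
  rewrite (odd_closed_walks Asym (fun=> c) 0); apply: eq_bigr => v _.
  by congr (_ * _); apply: eq_bigr => x _; apply: eq_bigr => y _.
have W v : p ^+ k.+2 * t v * phi v ^+ k.+1 - k.+3%:R * s <= closed_walks A (mu v) k.+2.
  have /andP[_ f1] := phi01 v; have s01 : 0 < s <= 1 by rewrite s0.
  exact: (@closed_walks_ge _ _ _ _ _ _ _ k.+1 A01 Asym (mu0c v) f1 p01' s01 dense).
split=> [irr|reg].
- have W' v : p ^+ k.+3 * phi v ^+ k.+3 - k.+4%:R * s <= closed_walks A (mu v) k.+2.
    apply: le_trans (W v); have /andP[f0 f1] := phi01 v.
    have td := dense _ (mu0c v); rewrite -/(phi v) -/(t v) in td.
    have q0 : 0 <= p ^+ k.+2 * phi v ^+ k.+1 by rewrite mulr_ge0// exprn_ge0.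
    have q1 : p ^+ k.+2 * phi v ^+ k.+1 <= 1.
      by apply: mulr_ile1 => //; rewrite ?exprn_ge0 ?exprn_ile1.
    have h := ler_wpM2l q0 td.
    have s2 : s ^+ 2 <= s by rewrite expr2 ler_piMl// ltW.
    have h2 : p ^+ k.+2 * phi v ^+ k.+1 * s ^+ 2 <= s.
      by apply: le_trans s2; rewrite ler_piMl// sqr_ge0.
    have -> : p ^+ k.+3 * phi v ^+ k.+3 = p ^+ k.+2 * phi v ^+ k.+1 * (p * phi v ^+ 2).
      by rewrite [p ^+ k.+3]exprS [phi v ^+ k.+3]exprS [phi v ^+ k.+2]exprS; ring.
    rewrite mulrBr in h; rewrite [k.+4%:R]mulrSr mulrDl mul1r; lra.
  have ed := edge_density_ge c0 c1 dense.
  have irr' : p ^+ k.+3 - k.+3%:R * s ^+ 2 + p ^+ k.+1 * sigma ^+ 2 <= \sum_v c * phi v ^+ k.+3.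
    apply: (@le_trans _ _ (\sum_v c * (p ^+ k.+3 + k.+3%:R * p ^+ k.+2 * (phi v - p)
         + p ^+ k.+1 * (phi v - p) ^+ 2))); last first.
      apply: ler_sum => v _; rewrite ler_wpM2l//; apply: exprSSn_tangent; last exact: ltW.
      by have /andP[] := phi01 v.
    have -> : \sum_v c * (p ^+ k.+3 + k.+3%:R * p ^+ k.+2 * (phi v - p)
         + p ^+ k.+1 * (phi v - p) ^+ 2) =
       p ^+ k.+3 + k.+3%:R * p ^+ k.+2 * (\sum_v c * walks_from A (fun=> c) 1 v - p)
       + p ^+ k.+1 * degree_variance A c p.
      rewrite -[X in _ = X + _ + _](avg_const c1) -[X in (_ - X)](avg_const c1).
      rewrite -sumrB /degree_variance !mulr_sumr -!big_split; apply: eq_bigr => v _.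
      by rewrite -phiE /=; ring.
    have := ler_wpM2l (ppow k.+1) irr.
    have h : - s ^+ 2 <= \sum_v c * walks_from A (fun=> c) 1 v - p by lra.
    have := ler_wpM2l (mulr_ge0 (ler0n R k.+3) (ppow k.+2)) h.
    have : k.+3%:R * p ^+ k.+2 * s ^+ 2 <= k.+3%:R * s ^+ 2.
      by rewrite ler_wpM2r ?sqr_ge0// ler_piMr.
    lra.
  apply: (@le_trans _ _ (\sum_v c * (p ^+ k.+3 * phi v ^+ k.+3 - k.+4%:R * s))); last first.
    by apply: ler_sum => v _; rewrite ler_wpM2l.
  under eq_bigr do rewrite mulrBr mulrCA.
  rewrite sumrB -mulr_sumr avg_const//.
  have := ler_wpM2l (ppow k.+3) irr'.
  have -> : p ^+ (k.+3 + k.+3) = p ^+ k.+3 * p ^+ k.+3 by rewrite exprD.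
  have -> : p ^+ (k.+2 + k.+2) = p ^+ k.+3 * p ^+ k.+1 by rewrite -exprD; congr (_ ^+ _); lia.
  have : p ^+ k.+3 * (k.+3%:R * s ^+ 2) <= k.+3%:R * s.
    apply: (@le_trans _ _ (k.+3%:R * s ^+ 2)).
      by rewrite ler_piMl// mulr_ge0// sqr_ge0.
    by rewrite ler_wpM2l// expr2 ler_piMl// ltW.
  have -> : (k.*2 + 7)%:R = k.+3%:R + k.+4%:R :> R by rewrite -natrD; congr (_%:R); lia.
  lra.
- apply: (@le_trans _ _ (\sum_v c * (p ^+ k.+2 * t v * phi v ^+ k.+1 - k.+3%:R * s))); last first.
    by apply: ler_sum => v _; rewrite ler_wpM2l.
  under eq_bigr do rewrite mulrBr.
  rewrite sumrB avg_const// lerD2r.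
  apply: (@le_trans _ _ (\sum_v c * (p ^+ (k.*2 + 3) * t v - k.+1%:R * `|phi v - p|))).
    have -> : \sum_v c * (p ^+ (k.*2 + 3) * t v - k.+1%:R * `|phi v - p|) =
        p ^+ (k.*2 + 3) * closed_walks A (fun=> c) 2 - k.+1%:R * degree_defect A c p.
      rewrite -tri /degree_defect !mulr_sumr -sumrB; apply: eq_bigr => v _.
      by rewrite -phiE; ring.
    by rewrite lerD2l lerN2 ler_wpM2l.
  apply: ler_sum => v _; rewrite ler_wpM2l//.
  have -> : (k.*2 + 3 = k.+2 + k.+1)%N by lia.
  have lip : p ^+ k.+1 <= phi v ^+ k.+1 + k.+1%:R * `|phi v - p|.
    apply: (exprn_lip _ p01 (phi01 v)) => //.
    by rewrite distrC -lerBlDl ler_norm.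
  have q0 : 0 <= p ^+ k.+2 * t v by rewrite mulr_ge0.
  have h := ler_wpM2l q0 lip.
  have : p ^+ k.+2 * t v * (k.+1%:R * `|phi v - p|) <= k.+1%:R * `|phi v - p|.
    by rewrite ler_piMl ?mulr_ge0// -[leRHS]mulr1 ler_pM.
  rewrite exprD; lra.
Qed.

Lemma cone_walks_forcing p kappa k : 0 < p < 1 -> 0 < kappa ->
  exists2 eps, 0 < eps <= 1 & forall T (A : T -> T -> R) c,
    normalized_kernel A c -> weighted_dense A p eps c ->
    p ^+ (k.+3 + k.+3) + eps < cone_walks A c k.+2 \/ cut_near A c p kappa.
Proof.
have hk : (k.+3 <= k.*2 + 7)%N by lia.
have ek : (k.+3 + k.+3 = k.*2 + 3 + 3)%N by lia.
move=> p01' k0; have /andP[p0 p1] := p01'.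
have [e3 /andP[e30 e31] tri] := closed_walks_forcing 0 p01' k0.
have q0 : 0 < p ^+ (k.*2 + 3) by rewrite exprn_gt0.
have q1 : p ^+ (k.*2 + 3) <= 1 by rewrite exprn_ile1 ?(ltW p0) ?(ltW p1).
(* Replacing degrees by [p] then costs half of the gain coming from triangles. *)
pose sigma := p ^+ (k.*2 + 3) * e3 / 2%:R / k.+1%:R.
have s0 : 0 < sigma by rewrite !divr_gt0// mulr_gt0.
have ks : k.+1%:R * sigma = p ^+ (k.*2 + 3) * e3 / 2%:R.
  by rewrite mulrC mulfVK// pnatr_eq0.
have s_ks : sigma <= k.+1%:R * sigma by rewrite ler_peMl ?(ltW s0)// ler1n.
have s1 : sigma <= 1.
  apply: le_trans s_ks _; rewrite ks.
  have : p ^+ (k.*2 + 3) * e3 <= 1 by rewrite -[leRHS]mulr1 ler_pM// ltW.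
  lra.
pose g := p ^+ (k.+2 + k.+2) * sigma ^+ 2.
have g0 : 0 < g by rewrite mulr_gt0// exprn_gt0.
(* This makes [g] at most the half of the triangle gain that is left, so errors of g/2 are
   affordable in both cases. *)
have gs : g <= sigma.
  apply: (@le_trans _ _ (sigma ^+ 2)).
    by rewrite ler_piMl ?sqr_ge0// exprn_ile1 ?(ltW p0) ?(ltW p1).
  by rewrite expr2 ler_piMl// ltW.
have N0 : 0 < (k.*2 + 7)%:R :> R by rewrite ltr0n addnS.
pose s := Num.min 1 (g / 2%:R / (k.*2 + 7)%:R).
have ss0 : 0 < s by rewrite lt_min ltr01 !divr_gt0.
have ss1 : s <= 1 by rewrite ge_min lexx.
have sN : (k.*2 + 7)%:R * s <= g / 2%:R.
  by rewrite mulrC -ler_pdivlMr// ge_min lexx orbT.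
have sN3 : k.+3%:R * s <= g / 2%:R.
  by apply: le_trans sN; rewrite ler_wpM2r ?(ltW ss0)// ler_nat.
exists (Num.min (Num.min e3 (s ^+ 2)) (g / 4%:R)).
  by rewrite !lt_min e30 exprn_gt0// divr_gt0//= !ge_min e31.
move=> T A c K; set eps := Num.min _ _ => dense.
have [A01 Asym c0 c1] := K.
have eps3 : eps <= e3 by rewrite /eps !ge_min lexx.
have epss : eps <= s ^+ 2 by rewrite /eps !ge_min lexx orbT.
have epsg : eps <= g / 4%:R by rewrite /eps !ge_min lexx orbT.
have [|big] := tri T A c K (weighted_dense_le eps3 dense); last by right.
have s01 : 0 < s <= 1 by rewrite ss0.
have [irr reg] := cone_walks_ge k K p01' s01 (ltW s0) (weighted_dense_le epss dense).
move=> big; left.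
have [/irr|/ltW/(degree_defect_le c0 c1 (ltW s0))/reg] :=
  lerP (sigma ^+ 2) (degree_variance A c p).
  apply: lt_le_trans; rewrite -/g; lra.
apply: lt_le_trans; rewrite ks.
have -> : p ^+ (k.+3 + k.+3) = p ^+ (k.*2 + 3) * p ^+ 3.
  by rewrite -exprD -ek.
have := ler_wpM2l (ltW q0) (ltW big); lra.
Qed.

End WheelSum.

(** * Forcing for cliques *)

Section GraphForcing.
Variable R : realType.
Implicit Types (G H : sgraph) (p delta eps : R).

Lemma KNRS_forcing_of_cut_near H :
  (forall p kappa : R, 0 < p < 1 -> 0 < kappa ->
    exists2 eps, 0 < eps <= 1 & forall G, (0 < #|vtx G|)%N ->
      weighted_dense (@adjk R G) p eps (vwt R G) ->
      p ^+ nedges H + eps < hom_dens R H G \/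
      cut_near (@adjk R G) (vwt R G) p kappa) ->
  KNRS_forcing R H.
Proof.
move=> hH p alpha p01 /andP[a0 _].
have [eps /andP[e0 e1] he] := hH p (2%:R * alpha) p01 (mulr_gt0 (ltr0n R 2) a0).
exists eps, eps; split=> // G n0 dense.
have e01 : 0 < eps <= 1 by rewrite e0.
have [|near] := he G n0 (locally_dense_weighted n0 p01 e01 dense); first by left.
by right; apply: quasirandom_of_cut_near near.
Qed.

Lemma cycle_forcing k : KNRS_forcing R (cycle_graph k.+3).
Proof.
apply: KNRS_forcing_of_cut_near => p kappa p01 k0.
have [eps e01 he] := closed_walks_forcing k p01 k0.
exists eps => // G n0 dense; rewrite nedges_cycle hom_dens_cycle.
exact: he (adjk_normalized R n0) dense.
Qed.

Lemma wheel_forcing k : KNRS_forcing R (wheel_graph k.+3).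
Proof.
apply: KNRS_forcing_of_cut_near => p kappa p01 k0.
have [eps e01 he] := cone_walks_forcing k p01 k0.
exists eps => // G n0 dense; rewrite nedges_wheel hom_dens_wheel.
exact: he (adjk_normalized R n0) dense.
Qed.

Lemma hom_dens_bound H G : 0 <= hom_dens R H G <= 1.
Proof.
rewrite /hom_dens divr_ge0 ?ler0n//=.
have [->|n0] := posnP #|{: {ffun vtx H -> vtx G}}|; first by rewrite invr0 mulr0.
by rewrite ler_pdivrMr ?ltr0n// mul1r ler_nat max_card.
Qed.

Lemma hom_dens_edgeless H G : (0 < #|vtx G|)%N ->
  (forall x y, adj H x y = false) -> hom_dens R H G = 1.
Proof.
move=> n0 noedge; rewrite /hom_dens.
have -> : [set f : {ffun vtx H -> vtx G} |
    [forall x, forall y, adj H x y ==> adj G (f x) (f y)]] = setT.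
  apply/setP => f; rewrite !inE; apply/forallP => x; apply/forallP => y.
  by rewrite noedge.
by rewrite cardsT divff// pnatr_eq0 card_ffun -lt0n expn_gt0 n0.
Qed.

Lemma hom_dens_clique3 G :
  hom_dens R (clique_graph 3) G = hom_dens R (cycle_graph 3) G.
Proof.
rewrite !hom_densE; apply: eq_bigr => f _; congr (_ * _%:R).
congr (nat_of_bool _); apply: eq_forallb => i; apply: eq_forallb => j /=.
by congr (_ ==> _); case: i => -[|[|[]]]// ?; case: j => -[|[|[]]]//.
Qed.

(** * Clique densities through common neighbourhoods *)

Section CliqueSum.
Variable G : sgraph.
Local Notation c := (vwt R G).
Let K k (g : {ffun 'I_k -> vtx G}) : R := (is_hom (H := clique_graph k) g)%:R.
Let N k (g : {ffun 'I_k -> vtx G}) (x : vtx G) : R := \prod_i adjk R x (g i).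

Lemma clique_cons k x (g : {ffun 'I_k -> vtx G}) :
  K (ffun_cons (unlift ord0) x g) = N g x * K g.
Proof.
rewrite /K /N /adjk -natr_forall -natr_andb; congr (nat_of_bool _)%:R.
apply/forallP/andP => [h|[/forallP h1 /forallP h2] i].
  split; apply/forallP => i.
    by have /forallP/(_ (lift ord0 i)) := h ord0; rewrite ffun_cons0 ffun_consS.
  apply/forallP => j.
  have /forallP/(_ (lift ord0 j)) := h (lift ord0 i); rewrite !ffun_consS /=.
  by rewrite (inj_eq lift_inj).
apply/forallP => j.
case: (unliftP ord0 i) => [i'|] ->; case: (unliftP ord0 j) => [j'|] ->.
- have /forallP/(_ j') := h2 i'; rewrite !ffun_consS /=.
  by rewrite (inj_eq lift_inj).
- by rewrite ffun_cons0 ffun_consS [adj G _ x]adj_sym h1 implybT.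
- by rewrite ffun_cons0 ffun_consS h1 implybT.
- by rewrite adj_irr.
Qed.

Lemma hom_dens_cliqueS k : hom_dens R (clique_graph k.+1) G =
  \sum_(g : {ffun 'I_k -> vtx G}) c ^+ k * K g * \sum_x c * N g x.
Proof.
rewrite hom_densE (big_ffun_cons _ (@ord_consK k) (@unliftK0 k)) exchange_big.
apply: eq_bigr => g _; rewrite mulr_sumr; apply: eq_bigr => x _.
by rewrite -/(K _) clique_cons card_ord exprS; ring.
Qed.

Lemma hom_dens_cliqueSS k : hom_dens R (clique_graph k.+2) G =
  \sum_(g : {ffun 'I_k -> vtx G}) c ^+ k * K g *
    \sum_x \sum_y (c * N g x) * (c * N g y) * adjk R x y.
Proof.
rewrite hom_densE (big_ffun_cons _ (@ord_consK k.+1) (@unliftK0 k.+1)).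
under eq_bigr do rewrite (big_ffun_cons _ (@ord_consK k) (@unliftK0 k)).
under eq_bigr do rewrite exchange_big.
rewrite exchange_big; apply: eq_bigr => g _; rewrite mulr_sumr.
apply: eq_bigr => x _; rewrite mulr_sumr; apply: eq_bigr => y _.
have Ncons : N (ffun_cons (unlift ord0) y g) x = adjk R x y * N g x.
  rewrite /N big_ord_recl ffun_cons0; congr (_ * _).
  by apply: eq_bigr => i _; rewrite ffun_consS.
by rewrite -/(K _) !clique_cons Ncons card_ord 2!exprS; ring.
Qed.

(** Fix a k-clique [g]. The pairs extending it to a (k+2)-clique are the adjacent pairs in its
    common neighbourhood, to which density applies; Cauchy-Schwarz over [g] compares with the
    extensions by one vertex. *)
Lemma clique_log_convex p delta k : (0 < #|vtx G|)%N -> 0 < p < 1 -> 0 <= delta ->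
  weighted_dense (@adjk R G) p delta c ->
  p * hom_dens R (clique_graph k.+1) G ^+ 2 - delta <=
  hom_dens R (clique_graph k) G * hom_dens R (clique_graph k.+2) G.
Proof.
move=> n0 /andP[p0 p1] d0 dense.
set t := hom_dens R (clique_graph k) G.
have /andP[t0 t1] : 0 <= t <= 1 by exact: hom_dens_bound.
have tE : t = \sum_(g : {ffun 'I_k -> vtx G}) c ^+ k * K g.
  by rewrite /t hom_densE card_ord.
have w0 (g : {ffun 'I_k -> vtx G}) : 0 <= c ^+ k * K g.
  by rewrite mulr_ge0 ?exprn_ge0 ?vwt_ge0 ?ler0n.
have lower : p * (\sum_(g : {ffun 'I_k -> vtx G}) c ^+ k * K g * (\sum_x c * N g x) ^+ 2)
    - delta * t <= hom_dens R (clique_graph k.+2) G.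
  rewrite hom_dens_cliqueSS tE !mulr_sumr -sumrB; apply: ler_sum => g _.
  rewrite mulrCA [delta * _]mulrC -mulrBr ler_wpM2l//; apply: dense => x.
  have /andP[N0 N1] : 0 <= N g x <= 1.
    by rewrite /N /adjk -natr_forall ler0n lern1 leq_b1.
  by rewrite mulr_ge0 ?vwt_ge0// ler_piMr ?vwt_ge0.
have cs := sqr_sum_le (fun g : {ffun 'I_k -> vtx G} => \sum_x c * N g x) w0.
rewrite -hom_dens_cliqueS -tE in cs.
have := ler_wpM2l t0 lower; have := ler_wpM2l (ltW p0) cs.
have tt1 : t * t <= 1 by rewrite mulr_ile1.
have := ler_wpM2l d0 tt1; lra.
Qed.

End CliqueSum.

(** The invariant of the induction on clique size: a gain in the ratio of consecutive densities,
    which propagates; a gain in the density itself; and a lower bound that makes division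
    harmless. *)
Definition clique_gain p eps k G : Prop :=
  [/\ (p ^+ k + eps) * hom_dens R (clique_graph k) G <= hom_dens R (clique_graph k.+1) G,
      p ^+ 'C(k.+1, 2) + eps <= hom_dens R (clique_graph k.+1) G
    & eps <= hom_dens R (clique_graph k) G].

Lemma clique_gain_step p eps k : 0 < p < 1 -> 0 < eps <= 1 ->
  exists2 eps' : R, 0 < eps' <= 1 & forall G, (0 < #|vtx G|)%N ->
    weighted_dense (@adjk R G) p eps' (vwt R G) ->
    clique_gain p eps k G -> clique_gain p eps' k.+1 G.
Proof.
move=> p01 /andP[e0 e1]; have /andP[p0 p1] := p01.
have q0 : 0 < p ^+ k.+1 by rewrite exprn_gt0.
have q1 : p ^+ k.+1 <= 1 by rewrite exprn_ile1 ?(ltW p0) ?(ltW p1).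
have qp : p ^+ k.+1 <= p by rewrite exprS ler_piMr ?(ltW p0)// exprn_ile1 ?(ltW p0) ?(ltW p1).
have e2 : eps * eps <= eps by rewrite ler_piMl// ltW.
have e3 : 0 < eps * eps by exact: mulr_gt0.
(* The density error is divided by a product of two clique densities, each at least [eps]; the other
   factors leave half of the ratio gain p eps and of the density gain p^(k+1) eps. *)
exists (p ^+ k.+1 * eps * (eps * eps) / 2%:R).
  rewrite divr_gt0 ?mulr_gt0//=.
  have : p ^+ k.+1 * eps * (eps * eps) <= 1.
    by rewrite !mulr_ile1 ?mulr_ge0 ?(ltW e0) ?(ltW q0).
  lra.
move=> G n0; set d := _ / 2%:R => dense [g1 g2 g3].
have d0 : 0 <= d by rewrite /d divr_ge0 ?mulr_ge0 ?(ltW e0) ?(ltW q0).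
have := clique_log_convex k n0 p01 d0 dense.
move: g1 g2 g3; set a := hom_dens _ _ _; set b := hom_dens _ _ _.
set z := hom_dens _ _ _ => g1 g2 g3 lc.
have a0 : 0 < a by exact: lt_le_trans g3.
have pc0 j : 0 <= p ^+ j by rewrite exprn_ge0 ?(ltW p0).
have be : eps <= b by apply: le_trans g2; rewrite lerDr.
have b0 : 0 < b by exact: lt_le_trans be.
have de : d <= p * eps / 2%:R * (a * b).
  have h1 : eps * eps <= a * b by rewrite ler_pM// ltW.
  have h2 : p ^+ k.+1 * eps <= p * eps by rewrite ler_wpM2r// ltW.
  have : p ^+ k.+1 * eps * (eps * eps) <= p * eps * (a * b).
    by rewrite ler_pM// ?mulr_ge0 ?(ltW e0) ?(ltW q0).
  rewrite /d; lra.
have dle : d <= p ^+ k.+1 * eps / 2%:R.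
  have : p ^+ k.+1 * eps * (eps * eps) <= p ^+ k.+1 * eps.
    by rewrite ler_piMr ?mulr_ge0 ?(ltW e0) ?(ltW q0)// (le_trans e2).
  rewrite /d; lra.
have dle' : d <= p * eps / 2%:R.
  have : p ^+ k.+1 * eps <= p * eps by rewrite ler_wpM2r// ltW.
  lra.
have ratio : (p ^+ k.+1 + p * eps / 2%:R) * b <= z.
  rewrite -(ler_pM2l a0); apply: le_trans lc.
  have h := ler_wpM2l (mulr_ge0 (ltW p0) (ltW b0)) g1.
  have -> : p ^+ k.+1 = p * p ^+ k by rewrite exprS.
  lra.
split.
- by apply: le_trans ratio; rewrite ler_wpM2r ?(ltW b0)// lerD2l.
- rewrite binS bin1 exprD; apply: le_trans ratio.
  apply: (@le_trans _ _ (p ^+ k.+1 * b)); last first.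
    by rewrite ler_wpM2r ?(ltW b0)// lerDl divr_ge0 ?mulr_ge0 ?(ltW p0) ?(ltW e0).
  have := ler_wpM2l (ltW q0) g2.
  have : 0 <= p ^+ k.+1 * eps by rewrite mulr_ge0 ?(ltW q0) ?(ltW e0).
  lra.
- apply: le_trans be; apply: le_trans dle _.
  have : p ^+ k.+1 * eps <= eps by rewrite ler_piMl ?(ltW e0).
  lra.
Qed.

Lemma clique_gain_steps p eps k j : 0 < p < 1 -> 0 < eps <= 1 ->
  exists2 eps' : R, 0 < eps' <= 1 & forall G, (0 < #|vtx G|)%N ->
    weighted_dense (@adjk R G) p eps' (vwt R G) ->
    clique_gain p eps k G -> clique_gain p eps' (k + j) G.
Proof.
move=> p01 e01; elim: j => [|j [e1 e101 IHj]].
  by exists eps => // G _ _; rewrite addn0.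
have [e2 /andP[e20 e21] step] := clique_gain_step (k + j) p01 e101.
have /andP[e10 e11] := e101.
exists (Num.min e1 e2); first by rewrite lt_min e10 e20 ge_min e11.
move=> G n0 dense gain.
have le1 : Num.min e1 e2 <= e1 by rewrite ge_min lexx.
have le2 : Num.min e1 e2 <= e2 by rewrite ge_min lexx orbT.
have := step G n0 (weighted_dense_le le2 dense).
move=> /(_ (IHj G n0 (weighted_dense_le le1 dense) gain)) [h1 h2 h3].
rewrite addnS; split.
- apply: le_trans h1; rewrite ler_wpM2r ?lerD2l//.
  by have /andP[] := hom_dens_bound (clique_graph (k + j).+1) G.
- by apply: le_trans h2; rewrite lerD2l.
- exact: le_trans h3.
Qed.

Lemma clique_forcing k : KNRS_forcing R (clique_graph k.+3).
Proof.
apply: KNRS_forcing_of_cut_near => p kappa p01 k0; have /andP[p0 p1] := p01.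
have [e3 /andP[e30 e31] tri] := closed_walks_forcing 0 p01 k0.
pose s := Num.min (e3 / 4%:R) (p / 2%:R).
have s0 : 0 < s by rewrite lt_min !divr_gt0.
have s3 : s <= e3 / 4%:R by rewrite ge_min lexx.
have sp : s <= p / 2%:R by rewrite ge_min lexx orbT.
have s01 : 0 < s <= 1 by rewrite s0; lra.
have [e1 /andP[e10 e11] gain1] := clique_gain_steps 1 k.+1 p01 s01.
have [e2 /andP[e20 e21] gain2] := clique_gain_steps 2 k p01 s01.
pose m := Num.min e1 e2.
have m0 : 0 < m by rewrite lt_min e10.
have me1 : m <= e1 by rewrite ge_min lexx.
have me2 : m <= e2 by rewrite ge_min lexx orbT.
pose d := Num.min (Num.min e3 (p / 2%:R)) (m / 2%:R).
have d0 : 0 < d by rewrite !lt_min e30 !divr_gt0.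
have de3 : d <= e3 by rewrite /d !ge_min lexx.
have dp : d <= p / 2%:R by rewrite /d !ge_min lexx orbT.
have dm : d <= m / 2%:R by rewrite /d !ge_min lexx orbT.
exists d; first by rewrite d0 (le_trans de3).
move=> G n0 dense; rewrite nedges_clique.
have [|big] := tri _ _ _ (adjk_normalized R n0) (weighted_dense_le de3 dense); last by right.
rewrite -hom_dens_cycle -hom_dens_clique3 => T3; left.
have T0 : hom_dens R (clique_graph 0) G = 1 by apply: hom_dens_edgeless => // -[].
have T1 : hom_dens R (clique_graph 1) G = 1.
  by apply: hom_dens_edgeless => // x y; rewrite /= (ord1 x) (ord1 y).
have T2 : p - d <= hom_dens R (clique_graph 2) G.
  have := clique_log_convex 0 n0 p01 (ltW d0) dense.
  by rewrite T0 T1 expr1n mulr1 mul1r.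
suff [e [de he]] : exists e, d < e /\ p ^+ 'C(k.+3, 2) + e <= hom_dens R (clique_graph k.+3) G.
  by apply: lt_le_trans he; rewrite ltrD2l.
(* Excess edges start the induction at k = 1. Otherwise the edge density is below p + s, so the
   triangle gain [e3] gives a ratio gain at k = 2. *)
have [big2|small2] := lerP (p + s) (hom_dens R (clique_graph 2) G).
  have dle : d <= e1 by lra.
  have g1 : clique_gain p s 1 G by split; rewrite ?T1 ?expr1 ?mulr1//; lra.
  have [_ h _] := gain1 G n0 (weighted_dense_le dle dense) g1.
  by exists e1; split; [lra|exact: h].
have dle : d <= e2 by lra.
have g2 : clique_gain p s 2 G.
  split; [|rewrite (_ : 'C(3, 2) = 3%N)//; lra|lra].
  have p2 : p ^+ 2 <= 1 by rewrite exprn_ile1 ?(ltW p0) ?(ltW p1).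
  have q0 : 0 <= p ^+ 2 + s by rewrite addr_ge0 ?sqr_ge0 ?(ltW s0).
  have h := ler_wpM2l q0 (ltW small2).
  have h1 : p ^+ 2 * s <= s by rewrite ler_piMl ?(ltW s0).
  have h2 : p * s <= s by rewrite ler_piMl ?(ltW s0) ?(ltW p1).
  have h3 : s * s <= s by rewrite ler_piMl ?(ltW s0)//; lra.
  apply: le_trans h _; apply: le_trans (ltW T3); rewrite [p ^+ 3]exprSr; lra.
have [_ h _] := gain2 G n0 (weighted_dense_le dle dense) g2.
by exists e2; split; [lra|exact: h].
Qed.

End GraphForcing.

(** * Products *)

Lemma delta_sum (T : finType) (t : T) n : (\sum_x (x == t) * n = n)%N.
Proof. by rewrite -big_distrl (bigD1 t)//= eqxx big1 ?mul1n// => x /negbTE ->. Qed.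

Section Extensions.
Variables (R : realType) (H1 : sgraph) (I : {set vtx H1}) (a : vtx H1).
Hypothesis aI : a \notin I.
Hypothesis indI : independent I.
Let P : finType := {x : vtx H1 | x \in I}.
Let Q : finType := {x : vtx H1 | x \notin I}.
Let aQ : Q := exist _ a aI.

(** Independence of [I] ensures that copies share no edges. The edges of [H2] join different copies,
    so they are not counted among those of the copies. *)
Lemma nedges_ltimes (H2 : sgraph) :
  nedges (ltimes I a H2) = (#|vtx H2| * nedges H1 + nedges H2)%N.
Proof.
apply/eqP; rewrite -(eqn_pmul2r (isT : 0 < 2)%N) mulnDl -mulnA !nedges_double.
apply/eqP.
pose p := (\sum_(x : P) \sum_(y : Q) adj H1 (val x) (val y))%N.
pose q := (\sum_(x : Q) \sum_(y : Q) adj H1 (val x) (val y))%N.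
have split1 (F : vtx H1 -> nat) :
    (\sum_x F x = \sum_(x : P) F (val x) + \sum_(x : Q) F (val x))%N.
  rewrite (bigID (mem I)) /= (big_sub (mem I)).
  by rewrite (big_sub (fun x => x \notin I)).
have pE : (\sum_(x : Q) \sum_(y : P) adj H1 (val x) (val y) = p)%N.
  rewrite exchange_big; apply: eq_bigr => x _; apply: eq_bigr => y _.
  by rewrite adj_sym.
have E1 : (\sum_x \sum_y adj H1 x y = p + (p + q))%N.
  rewrite split1; congr (_ + _)%N.
    apply: eq_bigr => x _; rewrite split1 big1 // => y _.
    by rewrite (negbTE (indI (valP x) (valP y))).
  rewrite -pE -big_split; apply: eq_bigr => x _ /=.
  by rewrite split1.
have sQ (F : Q * vtx H2 -> nat) : (\sum_u F u = \sum_x \sum_i F (x, i))%N.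
  by rewrite pair_bigA; apply: eq_bigr => -[].
rewrite E1 /= big_sumType /=.
have -> : (\sum_(x : P) \sum_(v : ltimes_vtx I H2) ltimes_adj a (inl x) v
    = #|vtx H2| * p)%N.
  rewrite big_distrr; apply: eq_bigr => x _ /=.
  rewrite big_sumType /= big1 ?add0n => [|y _]; last first.
    by rewrite (negbTE (indI (valP x) (valP y))).
  rewrite sQ big_distrr; apply: eq_bigr => y _ /=.
  by rewrite sum_nat_const.
rewrite sQ.
have -> : (\sum_(x : Q) \sum_i \sum_(v : ltimes_vtx I H2) ltimes_adj a (inr (x, i)) v
    = \sum_(x : Q) #|vtx H2| * (\sum_(y : P) adj H1 (val x) (val y))
    + \sum_(x : Q) (#|vtx H2| * (\sum_(y : Q) adj H1 (val x) (val y))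
       + (x == aQ) * \sum_i \sum_j adj H2 i j))%N.
  rewrite -big_split; apply: eq_bigr => x _ /=.
  under eq_bigr do rewrite big_sumType sQ /=.
  rewrite big_split sum_nat_const; congr (_ + _)%N.
  set r := (\sum_(y : Q) _)%N; have -> : (#|vtx H2| * r = \sum_(i : vtx H2) r)%N.
    by rewrite sum_nat_const.
  rewrite [X in (_ + X)%N]big_distrr -big_split.
  apply: eq_bigr => i _ /=.
  rewrite (eq_bigr (fun y : Q => adj H1 (val x) (val y)
      + (x == aQ) * ((y == aQ) * \sum_j adj H2 i j)))%N.
    rewrite big_split -big_distrr; congr (_ + _ * _)%N => /=.
    exact: delta_sum.
  move=> y _.
  rewrite (eq_bigr (fun j => (i == j) * adj H1 (val x) (val y)
      + (x == aQ) * ((y == aQ) * adj H2 i j)))%N.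
    rewrite big_split -!big_distrr -big_distrl /=; congr (_ + _)%N.
    by under eq_bigr do rewrite eq_sym; rewrite big_distrl; exact: delta_sum.
  move=> j _; rewrite -[x == aQ]val_eqE -[y == aQ]val_eqE /=.
  case: (eqVneq i j) => [<-|_] /=; last by case: eqP; case: eqP; case: adj.
  by rewrite adj_irr !andbF orbF !muln0 addn0 mul1n.
rewrite big_split /= -!big_distrr /= -/q.
rewrite pE.
have -> : (\sum_(x : Q) (x == aQ) * (\sum_i \sum_j adj H2 i j) = \sum_i \sum_j adj H2 i j)%N.
  exact: delta_sum.
by rewrite !mulnDr !addnA.
Qed.

Variable G : sgraph.
Local Notation V := (vtx G).

Definition glue (phi : {ffun P -> V}) (psi : {ffun Q -> V}) (x : vtx H1) : V :=
  if insub x is Some u then phi u else psi (insubd aQ x).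

Lemma glue_in phi psi (x : P) : glue phi psi (val x) = phi x.
Proof. by rewrite /glue valK. Qed.

Lemma glue_notin phi psi (x : Q) : glue phi psi (val x) = psi x.
Proof. by rewrite /glue insubF ?valKd//; apply/negbTE/(valP x). Qed.

Definition extends phi (psi : {ffun Q -> V}) : bool :=
  is_hom (H := H1) (glue phi psi).

Definition ext_vtx phi : finType := {psi : {ffun Q -> V} | extends phi psi}.

Definition ext_adj phi : rel (ext_vtx phi) :=
  fun s t => adj G (val s aQ) (val t aQ).

Lemma ext_sym phi : symmetric (@ext_adj phi).
Proof. by move=> s t; rewrite /ext_adj adj_sym. Qed.

Lemma ext_irr phi : irreflexive (@ext_adj phi).
Proof. by move=> s; rewrite /ext_adj adj_irr. Qed.

(* Homomorphisms of the product graph whose restriction to [I] is [phi]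
   correspond to homomorphisms of [H2] into this graph. *)
Definition ext_graph phi : sgraph := SGraph (@ext_sym phi) (@ext_irr phi).

Lemma vtx_cases (x : vtx H1) : (exists u : P, x = val u) \/ (exists u : Q, x = val u).
Proof. by case: (boolP (x \in I)) => h; [left|right]; exists (exist _ x h). Qed.

Lemma card_vtx_split : #|vtx H1| = (#|P| + #|Q|)%N.
Proof. by rewrite !card_sig -(cardC (mem I)); congr (_ + _)%N; apply: eq_card. Qed.

(** The probability that a uniformly random map on the complement of [I] extends [phi]. *)
Definition ext_weight phi : R := vwt R G ^+ #|Q| * (#|ext_vtx phi|)%:R.

Lemma hom_dens_glue :
  hom_dens R H1 G = \sum_(phi : {ffun P -> V}) vwt R G ^+ #|P| * ext_weight phi.
Proof.
rewrite hom_densE card_vtx_split exprD.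
pose join (q : {ffun P -> V} * {ffun Q -> V}) : {ffun vtx H1 -> V} :=
  [ffun x => glue q.1 q.2 x].
rewrite (reindex join); last first.
  exists (fun f : {ffun vtx H1 -> V} => ([ffun u : P => f (val u)], [ffun u : Q => f (val u)])).
    move=> [phi psi] _; congr (_, _); apply/ffunP => u; rewrite !ffunE /=.
      exact: glue_in.
    exact: glue_notin.
  move=> f _; apply/ffunP => x; rewrite ffunE /=.
  by have [[u ->]|[u ->]] := vtx_cases x; rewrite ?glue_in ?glue_notin ffunE.
rewrite -(pair_bigA _ (fun phi psi =>
   vwt R G ^+ #|P| * vwt R G ^+ #|Q| * (is_hom (join (phi, psi)))%:R)) /=.
apply: eq_bigr => phi _; rewrite -mulr_sumr -mulrA; congr (_ * (_ * _)).
rewrite card_sig -sum1_card natr_sum [RHS]big_mkcond; apply: eq_bigr => psi _.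
rewrite inE /extends /is_hom; under eq_forallb do under eq_forallb do rewrite !ffunE.
by case: ifP.
Qed.

Lemma sum_glue_const : (0 < #|V|)%N -> \sum_(phi : {ffun P -> V}) vwt R G ^+ #|P| = 1.
Proof.
move=> n0; rewrite sumr_const card_ffun -[_ *+ _]mulr_natr natrX -exprMn.
by rewrite vwtK// expr1n.
Qed.

Lemma ext_weight_bound phi : (0 < #|V|)%N -> 0 <= ext_weight phi <= 1.
Proof.
move=> n0; rewrite /ext_weight mulr_ge0 ?exprn_ge0 ?vwt_ge0//=.
apply: (@le_trans _ _ (vwt R G ^+ #|Q| * (#|V| ^ #|Q|)%:R)); last first.
  by rewrite natrX -exprMn vwtK// expr1n.
by rewrite ler_wpM2l ?exprn_ge0 ?vwt_ge0// ler_nat card_sig -card_ffun max_card.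
Qed.

Lemma is_hom_ltimes (H2 : sgraph) (f : {ffun vtx (ltimes I a H2) -> V})
    (phi : {ffun P -> V}) (Psi : {ffun vtx H2 -> {ffun Q -> V}}) :
  (forall u, f (inl u) = phi u) -> (forall u j, f (inr (u, j)) = Psi j u) ->
  is_hom f = [forall j, extends phi (Psi j)] && is_hom (H := H2) (fun j => Psi j aQ).
Proof.
move=> fl fr; apply/forallP/andP => [h|[/forallP h1 /forallP h2]]; first split.
- apply/forallP => j; apply/forallP => x; apply/forallP => y.
  have [[u ->]|[u ->]] := vtx_cases x; have [[v ->]|[v ->]] := vtx_cases y;
    rewrite ?glue_in ?glue_notin.
  + by have /forallP/(_ (inl v)) := h (inl u); rewrite !fl.
  + by have /forallP/(_ (inr (v, j))) := h (inl u); rewrite fl fr.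
  + by have /forallP/(_ (inl v)) := h (inr (u, j)); rewrite fl fr.
  + have /forallP/(_ (inr (v, j))) := h (inr (u, j)); rewrite !fr /= eqxx /=.
    by case: (adj H1 _ _).
- apply/forallP => i; apply/forallP => j; apply/implyP => ij.
  have /forallP/(_ (inr (aQ, j))) := h (inr (aQ, i)); rewrite !fr /=.
  by rewrite eqxx ij orbT.
have h1' j x y : adj H1 x y -> adj G (glue phi (Psi j) x) (glue phi (Psi j) y).
  by move=> xy; have /forallP/(_ x)/forallP/(_ y)/implyP := h1 j; apply.
move=> [u|[u i]]; apply/forallP => -[v|[v j]]; apply/implyP; rewrite /= ?fl ?fr.
- by rewrite (negbTE (indI (valP u) (valP v))).
- by move=> /(h1' j); rewrite glue_in glue_notin.
- by move=> /(h1' i); rewrite glue_in glue_notin.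
case/orP => [/andP[/eqP <-]|/and3P[ua va ij]].
  by move=> /(h1' i); rewrite !glue_notin.
have -> : u = aQ by apply: val_inj; apply/eqP.
have -> : v = aQ by apply: val_inj; apply/eqP.
by have /forallP/(_ j)/implyP := h2 i; apply.
Qed.

Lemma card_hom_ext (H2 : sgraph) phi :
  #|[set Psi : {ffun vtx H2 -> {ffun Q -> V}} |
      [forall j, extends phi (Psi j)] && is_hom (H := H2) (fun j => Psi j aQ)]| =
  #|[set h : {ffun vtx H2 -> vtx (ext_graph phi)} | is_hom h]|.
Proof.
pose F (h : {ffun vtx H2 -> vtx (ext_graph phi)}) : {ffun vtx H2 -> {ffun Q -> V}} :=
  [ffun j => val (h j)].
have Finj : injective F.
  move=> h h' /ffunP e; apply/ffunP => j; apply: val_inj.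
  by have := e j; rewrite !ffunE.
rewrite -(card_imset _ Finj); apply: eq_card => Psi; rewrite inE.
apply/andP/imsetP => [[/forallP ext hom]|[h]]; last first.
  rewrite inE => hom ->; split.
    by apply/forallP => j; rewrite ffunE (valP (h j)).
  apply/forallP => i; apply/forallP => j; rewrite !ffunE.
  by have /forallP/(_ i)/forallP/(_ j) := hom.
exists [ffun j => (exist _ (Psi j) (ext j) : ext_vtx phi)].
  rewrite inE; apply/forallP => i; apply/forallP => j; rewrite !ffunE.
  by have /forallP/(_ i)/forallP/(_ j) := hom.
by apply/ffunP => j; rewrite !ffunE.
Qed.

(** Given [phi], the copies of [H1] are independent extensions, and [H2] only constrains their
    values at [a]. *)
Lemma hom_dens_ltimes (H2 : sgraph) : hom_dens R (ltimes I a H2) G =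
  \sum_(phi : {ffun P -> V}) vwt R G ^+ #|P| *
    (hom_dens R H2 (ext_graph phi) * ext_weight phi ^+ #|vtx H2|).
Proof.
rewrite hom_densE card_sum card_prod exprD exprM.
pose join (q : {ffun P -> V} * {ffun vtx H2 -> {ffun Q -> V}}) :
    {ffun vtx (ltimes I a H2) -> V} :=
  [ffun w => match w with inl u => q.1 u | inr (u, j) => q.2 j u end].
rewrite (reindex join); last first.
  exists (fun f : {ffun vtx (ltimes I a H2) -> V} =>
    ([ffun u => f (inl u)], [ffun j => [ffun u => f (inr (u, j))]])).
    by move=> [phi Psi] _; congr (_, _); apply/ffunP => u; rewrite !ffunE //;
      apply/ffunP => x; rewrite !ffunE.
  by move=> f _; apply/ffunP => -[u|[u j]]; rewrite !ffunE.
rewrite -(pair_bigA _ (fun phi Psi => vwt R G ^+ #|P| *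
   vwt R G ^+ #|Q| ^+ #|vtx H2| * (is_hom (join (phi, Psi)))%:R)) /=.
apply: eq_bigr => phi _; rewrite -mulr_sumr -mulrA; congr (_ * _).
rewrite /ext_weight exprMn mulrCA; congr (_ * _).
transitivity ((#|[set h : {ffun vtx H2 -> vtx (ext_graph phi)} | is_hom h]|)%:R : R).
  rewrite -card_hom_ext -sum1_card natr_sum [RHS]big_mkcond; apply: eq_bigr => Psi _.
  rewrite inE (@is_hom_ltimes H2 _ phi Psi) => [|u|u j]; rewrite ?ffunE//.
  by case: ifP.
rewrite /hom_dens -natrX -card_ffun /is_hom.
(* If there is no map into the extensions, the density is a division by zero, and the homomorphism
   count is zero as well. *)
have [e|n0] := posnP #|{: {ffun vtx H2 -> ext_vtx phi}}|.
  rewrite e mulr0; apply/eqP; rewrite pnatr_eq0 -leqn0 -e; exact: max_card.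
by rewrite mulfVK// pnatr_eq0 -lt0n.
Qed.

(** Push the uniform measure on [S] forward to [G] by evaluation at [a]: its form counts the edges
    inside [S]. The mass of [S] is at least delta' tau, so lowering [p] to [p'] absorbs [delta]. *)
Lemma ext_locally_dense p p' delta delta' tau phi : (0 < #|V|)%N ->
  weighted_dense (@adjk R G) p delta (vwt R G) ->
  0 <= p' <= p -> 0 <= delta' -> 0 <= tau -> tau <= ext_weight phi ->
  delta <= (p - p') * (delta' * tau) ^+ 2 ->
  locally_dense p' delta' (ext_graph phi).
Proof.
move=> n0 dense /andP[p0 pp] d0 t0 wt dle S big.
set c := vwt R G in dense; have cn : c * (#|V|)%:R = 1 by exact: vwtK.
have c0 : 0 <= c by exact: vwt_ge0.
pose q := c ^+ #|Q|; have q0 : 0 <= q by exact: exprn_ge0.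
have qpos : 0 < q by rewrite exprn_gt0// invr_gt0 ltr0n.
pose g v := q * \sum_(s in S) (val s aQ == v)%:R.
have g0 v : 0 <= g v by rewrite mulr_ge0 ?sumr_ge0.
have gc v : g v <= c.
  apply: (@le_trans _ _ (q * \sum_(psi : {ffun Q -> V}) (psi aQ == v)%:R)).
    rewrite ler_wpM2l// -!natr_sum ler_nat.
    apply: (@leq_trans (\sum_(s : ext_vtx phi) (val s aQ == v))).
      by rewrite [leqRHS](bigID (mem S)) leq_addr.
    rewrite -(big_sub (extends phi) (fun psi : {ffun Q -> V} => (psi aQ == v : nat))).
    by rewrite [leqRHS](bigID (extends phi)) leq_addr.
  (* Fixing the value at [a] leaves |V|^(|Q|-1) maps; factoring the indicator over coordinates
     computes this count. *)
  rewrite (eq_bigr (fun psi : {ffun Q -> V} =>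
      \prod_u (if u == aQ then (psi u == v)%:R else 1))); last first.
    move=> psi _; rewrite (bigD1 aQ)//= eqxx big1 ?mulr1// => u /negbTE ->//.
  rewrite -(bigA_distr_bigA (fun (u : Q) (x : V) => if u == aQ then (x == v)%:R else 1 : R)).
  rewrite (bigD1 aQ)//= eqxx (bigD1 v)//= eqxx big1 ?addr0 ?mul1r; last first.
    by move=> x /negbTE ->.
  rewrite (eq_bigr (fun=> (#|V|)%:R)); last first.
    by move=> u /negbTE ->; rewrite sumr_const.
  rewrite prodr_const (@eq_card Q _ (predC1 aQ))// cardC1 /q.
  have : (0 < #|Q|)%N by apply/card_gt0P; exists aQ.
  case: #|Q| => // k _; rewrite exprS -mulrA -exprMn.
  by rewrite cn expr1n mulr1.
have gsum : \sum_v g v = q * (#|S|)%:R.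
  rewrite -mulr_sumr exchange_big -sum1_card natr_sum; congr (_ * _).
  apply: eq_bigr => s _; rewrite (bigD1 (val s aQ))//= eqxx big1 ?addr0//.
  by move=> x; rewrite eq_sym => /negbTE ->.
have gform : \sum_v \sum_w g v * g w * adjk R v w = q ^+ 2 * ((e_in S)%:R * 2%:R).
  rewrite e_in_double_adjk.
  transitivity (\sum_v \sum_w \sum_(s in S) \sum_(t in S) q ^+ 2 *
     ((val s aQ == v)%:R * ((val t aQ == w)%:R * adjk R v w))).
    apply: eq_bigr => v _; apply: eq_bigr => w _.
    rewrite /g mulrACA -expr2 -mulrA mulr_suml mulr_suml mulr_sumr.
    apply: eq_bigr => s _; rewrite mulr_sumr mulr_suml mulr_sumr.
    by apply: eq_bigr => t _; ring.
  under eq_bigr do rewrite exchange_big.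
  rewrite exchange_big mulr_sumr; apply: eq_bigr => s _.
  under eq_bigr do rewrite exchange_big.
  rewrite exchange_big mulr_sumr; apply: eq_bigr => t _.
  rewrite (bigD1 (val s aQ))//= [X in _ + X]big1 ?addr0; last first.
    by move=> v; rewrite eq_sym => /negbTE h; rewrite big1// => w _; rewrite h mul0r mulr0.
  rewrite (bigD1 (val t aQ))//= [X in _ + X]big1 ?addr0; last first.
    by move=> w; rewrite eq_sym => /negbTE h; rewrite h mul0r !mulr0.
  by rewrite !eqxx !mul1r.
have gbound v : 0 <= g v <= c by rewrite g0 gc.
have := dense g gbound; rewrite gsum gform => ld.
have sz : delta' * tau <= q * (#|S|)%:R.
  apply: (@le_trans _ _ (q * (delta' * (#|ext_vtx phi|)%:R))).
    by rewrite mulrCA ler_wpM2l.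
  by rewrite ler_wpM2l.
have sz2 : (delta' * tau) ^+ 2 <= (q * (#|S|)%:R) ^+ 2.
  by rewrite lerXn2r ?nnegrE ?mulr_ge0.
have pp' : 0 <= p - p' by rewrite subr_ge0.
have h := ler_wpM2l pp' sz2.
rewrite ler_pdivrMr// -(ler_pM2l (exprn_gt0 2 qpos)).
rewrite mulrCA -exprMn; lra.
Qed.

End Extensions.

(** * Forcing for the product *)

Lemma locally_dense_le (R : realType) (p delta delta' : R) G :
  delta <= delta' -> locally_dense p delta G -> locally_dense p delta' G.
Proof.
by move=> dd dense S big; apply: dense; apply: le_trans big; rewrite ler_wpM2r.
Qed.

Lemma ltimes_forcing (R : realType) (H1 : sgraph) (I : {set vtx H1}) (a : vtx H1)
    (H2 : sgraph) :
  KNRS_forcing R H1 -> independent I -> a \notin I -> (0 < #|vtx H2|)%N ->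
  KNRS R H2 -> KNRS_forcing R (ltimes I a H2).
Proof.
move=> force1 indI aI w0 knrs2 p alpha p01 alpha01; have /andP[p0 p1] := p01.
have [delta1 [eps1 [d10 e10 he1]]] := force1 p alpha p01 alpha01.
have [w wE] : exists w, #|vtx H2| = w.+1 by case: #|vtx H2| w0 => // w _; exists w.
have mE := nedges_ltimes aI indI H2; rewrite wE in mE.
(* [KNRS] is unfolded to expose [nedges H2], which is then generalised. *)
have {}knrs2 : forall p eps : R, 0 < p < 1 -> 0 < eps < 1 ->
    exists delta : R, 0 < delta /\
      forall G : sgraph, (0 < #|vtx G|)%N -> locally_dense p delta G ->
        p ^+ nedges H2 - eps <= hom_dens R H2 G by [].
move: (nedges H1) (nedges H2) mE he1 knrs2 => m1 m2 mE he1 knrs2.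
pose gain := Num.min eps1 1.
have gain0 : 0 < gain by rewrite lt_min e10 ltr01.
have gain1 : gain <= 1 by rewrite ge_min lexx orbT.
have pow0 j : 0 < p ^+ j by rewrite exprn_gt0.
have pow1 j : p ^+ j <= 1 by rewrite exprn_ile1 ?(ltW p0) ?(ltW p1).
(* The gain surviving in the power w+1 of the density of [H1]; [eps2] is an eighth of its
   contribution. *)
pose kappa := (p ^+ m1) ^+ w * gain.
have kappa0 : 0 < kappa by rewrite mulr_gt0// exprn_gt0.
have kappa1 : kappa <= 1.
  by rewrite mulr_ile1 ?exprn_ile1 ?exprn_ge0 ?(ltW gain0) ?(ltW p0) ?(ltW p1).
pose eps2 := p ^+ m2 * kappa / 8%:R.
have e20 : 0 < eps2 by rewrite divr_gt0// mulr_gt0.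
have e28 : eps2 <= p ^+ m2 / 8%:R.
  by rewrite /eps2 ler_pM2r ?invr_gt0// ler_piMr// ltW.
have e21 : 0 < eps2 < 1.
  by rewrite e20 (le_lt_trans e28)//; have := pow1 m2; lra.
have M0 : 0 < m2.+1%:R :> R by rewrite ltr0n.
(* The density of [H2] is used at p' = p - loss; the second bound keeps the change in p^m2 below
   [eps2]. *)
pose loss := Num.min (p / 2%:R) (eps2 / m2.+1%:R).
have loss0 : 0 < loss by rewrite lt_min divr_gt0// divr_gt0.
have lossp : loss <= p / 2%:R by rewrite ge_min lexx.
have losse : m2%:R * loss <= eps2.
  apply: (@le_trans _ _ (m2.+1%:R * loss)).
    by rewrite ler_wpM2r ?(ltW loss0)// ler_nat.
  by rewrite mulrC -ler_pdivlMr// ge_min lexx orbT.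
pose p' := p - loss.
have p'01 : 0 < p' < 1 by rewrite /p'; lra.
have p'pow : p ^+ m2 <= p' ^+ m2 + eps2.
  apply: (@le_trans _ _ (p' ^+ m2 + m2%:R * loss)); last by rewrite lerD2l.
  apply: exprn_lip; rewrite ?(ltW p0) ?(ltW p1) ?(ltW loss0) ?subrK//.
  by have /andP[a1 a2] := p'01; rewrite !ltW.
have [delta' [d'0 he2]] := knrs2 p' eps2 p'01 e21.
pose delta := Num.min (Num.min delta1 1) (loss * (delta' * eps2) ^+ 2).
have d0 : 0 < delta.
  by rewrite !lt_min d10 ltr01 mulr_gt0// exprn_gt0// mulr_gt0.
have dd1 : delta <= delta1 by rewrite !ge_min lexx.
have d1 : delta <= 1 by rewrite !ge_min lexx orbT.
have dle : delta <= loss * (delta' * eps2) ^+ 2 by rewrite !ge_min lexx !orbT.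
exists delta, eps2; split=> // G n0 dense.
have [big|] := he1 G n0 (locally_dense_le dd1 dense); [left|by right].
have d01 : 0 < delta <= 1 by rewrite d0.
have wdense := locally_dense_weighted n0 p01 d01 dense.
(* One [eps2] pays for passing to [p'], the other for the error in the KNRS property. *)
set beta := p ^+ m2 - 2%:R * eps2.
have beta1 : beta <= 1 by rewrite /beta; have := pow1 m2; lra.
have beta0 : 0 <= beta by rewrite /beta; have := pow0 m2; lra.
rewrite mE (hom_dens_ltimes R aI indI) wE.
pose y (phi : {ffun {x : vtx H1 | x \in I} -> vtx G}) := ext_weight R aI phi.
have y01 phi : 0 <= y phi <= 1 by exact: ext_weight_bound.
have term phi : beta * y phi ^+ w.+1 - eps2 <=
    hom_dens R H2 (ext_graph aI phi) * y phi ^+ w.+1.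
  have /andP[y0 y1] := y01 phi.
  have yw0 : 0 <= y phi ^+ w.+1 by rewrite exprn_ge0.
  (* Maps with few extensions have main term at most [eps2], which the subtracted error covers. *)
  have [heavy|light] := lerP eps2 (y phi).
    apply: (@le_trans _ _ (beta * y phi ^+ w.+1)); first by rewrite gerBl ltW.
    rewrite ler_wpM2r//; apply: (@le_trans _ _ (p' ^+ m2 - eps2)).
      rewrite /beta; lra.
    apply: he2.
      rewrite lt0n; apply: contraTneq heavy => m0.
      by rewrite -ltNge /y /ext_weight m0 mulr0.
    apply: (ext_locally_dense n0 wdense _ (ltW d'0) (ltW e20) heavy).
      by have /andP[a1 a2] := p'01; rewrite /p' gerBl !ltW.
    by rewrite /p' opprB addrC subrK.
  have /andP[h0 _] := hom_dens_bound R H2 (ext_graph aI phi).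
  apply: (@le_trans _ _ 0); last by rewrite mulr_ge0.
  rewrite subr_le0; apply: le_trans (ltW light).
  rewrite exprS mulrCA ler_piMr// mulr_ile1// ?exprn_ge0//.
  by rewrite exprn_ile1.
have wt0 (phi : {ffun {x : vtx H1 | x \in I} -> vtx G}) :
    0 <= vwt R G ^+ #|{: {x : vtx H1 | x \in I}}| by rewrite exprn_ge0 ?vwt_ge0.
have wt1 := sum_glue_const R I n0.
have jensen := jensen_pow w wt0 (fun phi => proj1 (andP (y01 phi))) wt1.
rewrite -hom_dens_glue in jensen.
set t1 := hom_dens R H1 G in big jensen.
have total : beta * t1 ^+ w.+1 - eps2 <= \sum_(phi : {ffun {x : vtx H1 | x \in I} -> vtx G})
    vwt R G ^+ #|{: {x : vtx H1 | x \in I}}| *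
      (hom_dens R H2 (ext_graph aI phi) * y phi ^+ w.+1).
  apply: (@le_trans _ _ (\sum_(phi : {ffun {x : vtx H1 | x \in I} -> vtx G})
    vwt R G ^+ #|{: {x : vtx H1 | x \in I}}| * (beta * y phi ^+ w.+1 - eps2))).
    under eq_bigr do rewrite mulrBr mulrCA.
    by rewrite sumrB -mulr_sumr -mulr_suml wt1 mul1r lerD2r ler_wpM2l.
  by apply: ler_sum => phi _; apply: ler_wpM2l (term phi); exact: wt0 phi.
apply: lt_le_trans total.
have /andP[t0 t1le] : 0 <= t1 <= 1 by exact: hom_dens_bound.
have tw1 : t1 ^+ w.+1 <= 1 by rewrite exprn_ile1.
have tw : (p ^+ m1) ^+ w.+1 + kappa <= t1 ^+ w.+1.
  apply: le_trans (exprn_ge_gain w (ltW (pow0 m1)) (ltW gain0)) _.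
  rewrite lerXn2r ?nnegrE ?addr_ge0 ?(ltW gain0) ?(ltW (pow0 m1))//.
  by apply: le_trans (ltW big); rewrite lerD2l ge_min lexx.
have -> : p ^+ (w.+1 * m1 + m2) = p ^+ m2 * (p ^+ m1) ^+ w.+1.
  by rewrite exprD mulnC exprM mulrC.
have h1 := ler_wpM2l (ltW (pow0 m2)) tw.
have h2 : eps2 * t1 ^+ w.+1 <= eps2 by rewrite ler_piMr// ltW.
have h3 : p ^+ m2 * kappa = 8%:R * eps2 by rewrite [RHS]mulrC divfK// pnatr_eq0.
(* Of the gain 8 eps2, at most 3 eps2 is lost to [beta] and the light maps, leaving more than
   [eps2]. *)
rewrite mulrDr h3 in h1; rewrite /beta mulrBl -mulrA; clear -h1 h2 e20; lra.
Qed.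

Theorem theorem1p7 (R : realType) :
  (forall k : nat, (3 <= k)%N ->
     [/\ KNRS_forcing R (clique_graph k), KNRS_forcing R (cycle_graph k)
       & KNRS_forcing R (wheel_graph k)]) /\
  (forall (H1 : sgraph) (I : {set vtx H1}) (a : vtx H1) (H2 : sgraph),
     KNRS_forcing R H1 -> independent I -> a \notin I ->
     (0 < #|vtx H2|)%N -> KNRS R H2 ->
     KNRS_forcing R (ltimes I a H2)).
Proof.
split; last exact: ltimes_forcing.
case=> [|[|[|k]]] // _.
by split; [exact: clique_forcing | exact: cycle_forcing | exact: wheel_forcing].
Qed.
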